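(* Let $M$ be the family of dyadic cubes in $\mathbb{R}^n$. Let $0<p_0<p_1<\infty$, $0<q_0,q_1,q\le\infty$, $\theta\in(0,1)$, and let $p$ be defined by $\frac1p=\frac{1-\theta}{p_0}+\frac{\theta}{p_1}$. Then $$\big(N_{p_0,q_0}(M),N_{p_1,q_1}(M)\big)_{\theta,q}=N_{p,q}(M).$$
   Context: Dyadic cubes: $M$ is the family of all sets $$Q^m_k=\left[\tfrac{k_1}{2^m},\tfrac{k_1+1}{2^m}\right)\times\cdots\times\left[\tfrac{k_n}{2^m},\tfrac{k_n+1}{2^m}\right),\qquad k\in\mathbb{Z}^n,\ m\in\mathbb{Z}.$$ Net spaces: $|e|$ denotes the $n$-dimensional Lebesgue measure of $e$. For a function $f$ on $\mathbb{R}^n$ that is defined and integrable on each $e\in M$, put $$\bar f(t,M)=\sup_{e\in M,\ |e|\ge t}\frac1{|e|}\left|\int_e f(x)\,dx\right|,\qquad t>0.$$ For $0<p\le\infty$, $0<q\le\infty$, the net space $N_{p,q}(M)$ is the set of all such $f$ (identified when equal almost everywhere) for which $$\|f\|_{N_{p,q}(M)}=\left(\int_0^\infty\big(t^{1/p}\bar f(t,M)\big)^q\frac{dt}{t}\right)^{1/q}<\infty\quad(q<\infty),\qquad \|f\|_{N_{p,\infty}(M)}=\sup_{t>0}t^{1/p}\bar f(t,M)<\infty\quad (q=\infty).$$ Real interpolation: for a compatible pair $(A_0,A_1)$ of (quasi-)normed spaces and $a\in A_0+A_1$, $t>0$, the Peetre functional is $$K(t,a)=K(t,a;A_0,A_1)=\inf_{a=a_0+a_1}\big(\|a_0\|_{A_0}+t\|a_1\|_{A_1}\big).$$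 For $0<\theta<1$, $(A_0,A_1)_{\theta,q}$ is the set of $a\in A_0+A_1$ with finite quasi-norm $$\|a\|_{(A_0,A_1)_{\theta,q}}=\left(\int_0^\infty\big(t^{-\theta}K(t,a)\big)^q\frac{dt}{t}\right)^{1/q}\ (0<q<\infty),\qquad \|a\|_{(A_0,A_1)_{\theta,\infty}}=\sup_{0<t<\infty}t^{-\theta}K(t,a).$$ Equality of spaces means, as usual in interpolation theory, that the two spaces coincide as sets and their quasi-norms are equivalent. *)

(* Defs.v *)
From HB Require Import structures.
From mathcomp Require Import all_boot all_order all_algebra.
From mathcomp Require Import generic_quotient ring_quotient.
From mathcomp Require Import all_classical all_reals all_analysis.
From mathcomp Require Import measurable_realfun.

Set Implicit Arguments.
Unset Strict Implicit.
Unset Printing Implicit Defensive.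

Import Order.TTheory GRing.Theory Num.Theory.
Import numFieldNormedType.Exports.

Local Open Scope classical_set_scope.
Local Open Scope ring_scope.
Local Open Scope quotient_scope.

(* [measurableTypeR R] is R with its Borel sigma-algebra in the display used by
   [lebesgue_measure]; the tuple type carries the product sigma-algebra. *)
Notation Rn R n := (n.-tuple (measurableTypeR R)).

Section cons_measure.
Context {R : realType} {n : nat}.

Definition tuple_of_pair (x : measurableTypeR R * Rn R n) : Rn R n.+1 :=
  [tuple of x.1 :: x.2].

Lemma measurable_tuple_of_pair : measurable_fun setT tuple_of_pair.
Proof. exact: measurable_cons. Qed.

Variable mu : {sigma_finite_measure set (Rn R n) -> \bar R}.

Definition cons_measure : set (Rn R n.+1) -> \bar R :=
  pushforward (@lebesgue_measure R \x mu)%E tuple_of_pair.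

Let mpre A : measurable A -> measurable (tuple_of_pair @^-1` A).
Proof.
by move=> mA; rewrite -[X in measurable X]setTI; exact: measurable_tuple_of_pair.
Qed.

Let cons_measure0 : cons_measure set0 = 0%E.
Proof. by rewrite /cons_measure /pushforward preimage_set0 measure0. Qed.

Let cons_measure_ge0 A : (0 <= cons_measure A)%E.
Proof. by rewrite /cons_measure /pushforward measure_ge0. Qed.

Let cons_measure_sigma_additive : semi_sigma_additive cons_measure.
Proof.
move=> F mF tF mUF; rewrite /cons_measure /pushforward preimage_bigcup.
apply: measure_semi_sigma_additive => [k||].
- exact: mpre.
- apply/trivIsetP => i j _ _ ij; rewrite -preimage_setI.
  by move/trivIsetP : tF => /(_ _ _ I I ij) ->; rewrite preimage_set0.
- by rewrite -preimage_bigcup; exact: mpre.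
Qed.

HB.instance Definition _ := isMeasure.Build _ _ _ cons_measure
  cons_measure0 cons_measure_ge0 cons_measure_sigma_additive.

Let cons_measure_sigma_finite : sigma_finite setT cons_measure.
Proof.
have /sigma_finiteP[F [FT ndF Foo]] := sigma_finiteT (@lebesgue_measure R).
have /sigma_finiteP[G [GT ndG Goo]] := sigma_finiteT mu.
exists (fun k => [set x | F k (thead x) /\ G k [tuple of behead x]]).
  apply/seteqP; split=> // x _.
  have [i _ Fi] : (\bigcup_i F i) (thead x) by rewrite -FT.
  have [j _ Gj] : (\bigcup_i G i) [tuple of behead x] by rewrite -GT.
  exists (maxn i j) => //; split.
  - by move: Fi; apply/subsetPset/ndF/leq_maxl.
  - by move: Gj; apply/subsetPset/ndG/leq_maxr.
move=> k; have [mF Fk] := Foo k; have [mG Gk] := Goo k; split.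
  apply: measurableI; rewrite -[X in measurable X]setTI.
  - exact: (measurable_tnth ord0).
  - exact: measurable_behead.
rewrite /cons_measure /pushforward [X in (_ \x _)%E X](_ : _ = F k `*` G k).
  by rewrite product_measure1E// lte_mul_pinfty// ge0_fin_numE.
apply/seteqP; split=> -[x t] /=; rewrite theadE.
  by move=> [Fx]; rewrite (_ : [tuple of _] = t)//; exact: val_inj.
by move=> [Fx Gt]; rewrite (_ : [tuple of _] = t)//; exact: val_inj.
Qed.

HB.instance Definition _ := Measure_isSigmaFinite.Build _ _ _
  cons_measure cons_measure_sigma_finite.

End cons_measure.

(* n-dimensional Lebesgue measure, as an iterated product transported along
   R * R^n -> R^(n+1); [lebesgue_box] below gives the measure of boxes *)
Fixpoint lebesgue_tuple (R : realType) (n : nat) :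
    {sigma_finite_measure set (Rn R n) -> \bar R} :=
  match n with
  | 0%N => \d_([tuple] : Rn R 0)
  | n'.+1 => cons_measure (lebesgue_tuple R n')
  end.

Lemma lebesgue_box (R : realType) (n : nat) (a b : 'I_n -> R) :
  (forall i, a i <= b i) ->
  lebesgue_tuple R n [set x | forall i, a i <= tnth x i < b i] =
  (\prod_i (b i - a i))%:E.
Proof.
elim: n a b => [|n IHn] a b ab.
  by rewrite big_ord0 /= diracE mem_set//= => -[].
rewrite /= /cons_measure /pushforward big_ord_recl.
pose A := `[a ord0, b ord0[%classic.
pose B := [set x : Rn R n |
  forall i, a (lift ord0 i) <= tnth x i < b (lift ord0 i)].
have mB : measurable B.
  rewrite (_ : B = \bigcap_(i in [set: 'I_n])
     ((@tnth _ _)^~ i @^-1` `[a (lift ord0 i), b (lift ord0 i)[%classic)).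
    apply: fin_bigcap_measurable => // i _; rewrite -[X in measurable X]setTI.
    exact: measurable_tnth.
  apply/seteqP; split=> x Bx i; [move=> _|]; have := Bx i;
    by rewrite /= in_itv/= => // /(_ I).
rewrite [X in (_ \x _)%E X](_ : _ = A `*` B).
  have muB : lebesgue_tuple R n B = _ := IHn _ _ (fun i => ab (lift ord0 i)).
  have mA : measurable (A : set (measurableTypeR R)).
    exact: (measurable_itv `[a ord0, b ord0[).
  rewrite (product_measure1E lebesgue_measure (lebesgue_tuple R n) mA mB) muB.
  rewrite EFinM; congr (_ * _)%E.
  transitivity (if ((a ord0)%:E < (b ord0)%:E)%E
                then ((b ord0)%:E - (a ord0)%:E)%E else 0%E).
    exact: (lebesgue_measure_itv `[a ord0, b ord0[).
  rewrite lte_fin -EFinB; have [//|ba] := ltP (a ord0) (b ord0).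
  by have -> : a ord0 = b ord0; [apply/le_anti; rewrite ab ba|rewrite subrr].
apply/seteqP; split=> -[x t] /=.
  move=> H; split; first by rewrite /A /= in_itv /=; exact: (H ord0).
  by move=> i; have := H (lift ord0 i); rewrite tnthS.
rewrite /A /= in_itv /= => -[xA tB] i.
by case: (unliftP ord0 i) => [j|] ->//; rewrite tnthS; exact: tB.
Qed.

Section ae_classes.
Context d (T : measurableType d) (R : realType).
Variable mu : {measure set T -> \bar R}.

Definition ae_zero : {pred {mfun T >-> R}} :=
  fun f => `[< f = cst 0 %[ae mu] >].

Lemma ae_zero_zmod_closed : zmod_closed ae_zero.
Proof.
split=> [|f g]; rewrite /ae_zero !unfold_in /=.
  by apply/asboolP; apply: aeW.
move=> /asboolP f0 /asboolP g0; apply/asboolP.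
apply: filterS2 f0 g0 => x /(_ I) fx /(_ I) gx _.
by change (f x - g x = 0); rewrite fx gx subrr.
Qed.

HB.instance Definition _ :=
  GRing.isZmodClosed.Build _ ae_zero ae_zero_zmod_closed.

(* Real-valued measurable functions on T modulo equality almost everywhere. With
   T = R^n, measurability is Borel measurability; since every Lebesgue measurable
   function is a.e. equal to a Borel one, this gives the usual classes. *)
Definition L0 : Type := Quotient.quot ae_zero.

HB.instance Definition _ := GRing.Zmodule.on L0.

Definition L0_class (f : {mfun T >-> R}) : L0 := \pi_(Quotient.quot ae_zero) f.

Definition L0_repr (a : L0) : {mfun T >-> R} := repr (a : Quotient.quot ae_zero).

Lemma L0_class_eqP (f g : {mfun T >-> R}) :
  L0_class f = L0_class g <-> f = g %[ae mu].
Proof.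
split=> [/eqP|fg].
  rewrite -Quotient.idealrBE => /asboolP; apply: filterS => x /(_ I) fgx _.
  by apply/eqP; rewrite -subr_eq0; apply/eqP; exact: fgx.
apply/eqP; rewrite -Quotient.idealrBE; apply/asboolP.
by apply: filterS fg => x /(_ I) fgx _; change (f x - g x = 0); rewrite fgx subrr.
Qed.

Lemma L0_reprK (a : L0) : L0_class (L0_repr a) = a.
Proof. exact: reprK. Qed.

Lemma L0_classD (f g : {mfun T >-> R}) :
  L0_class (f + g) = L0_class f + L0_class g.
Proof. exact: Quotient.pi_add. Qed.

End ae_classes.

Section dyadic_cubes.
Context (R : realType) (n : nat).
Local Notation mu := (lebesgue_tuple R n).

Definition dyadic_cube (m : int) (k : 'I_n -> int) : set (Rn R n) :=
  [set x | forall i, (k i)%:~R / 2 ^ m <= tnth x i < (k i + 1)%:~R / 2 ^ m].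

Definition dyadic_cubes : set (set (Rn R n)) :=
  [set Q | exists m k, Q = dyadic_cube m k].

Lemma lebesgue_dyadic_cube m k :
  mu (dyadic_cube m k) = ((2 ^ m)^-1 ^+ n)%:E.
Proof.
have m0 : 0 < (2 : R) ^ m by rewrite exprz_gt0.
rewrite lebesgue_box => [|i]; last first.
  by rewrite ler_pM2r ?invr_gt0// ler_int lerDl.
rewrite (eq_bigr (fun=> (2 ^ m)^-1)) ?prodr_const ?card_ord// => i _.
by rewrite -mulrBl rmorphD/= addrAC subrr add0r mul1r.
Qed.

End dyadic_cubes.
Arguments dyadic_cubes : clear implicits.

Section mellin_norm.
Context {R : realType}.
Local Open Scope ereal_scope.

(* the quasi-norm of L^q((0, +oo), dt/t), except that for [q = +oo] it is a
   true supremum rather than an essential one *)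
Definition mellin_norm (q : \bar R) (phi : R -> \bar R) : \bar R :=
  match q with
  | r%:E => (\int[lebesgue_measure]_(t in `]0%R, +oo[)
               (phi t `^ r * (t^-1)%:E)) `^ r^-1
  | +oo => ereal_sup [set phi t | t in `]0%R, +oo[]
  | -oo => 0 (* not used: exponents are positive *)
  end.

End mellin_norm.

(* A quasi-normed space whose elements live in an ambient additive group V: its
   set of elements and its quasi-norm. The values of [qnorm] outside [qcar] are
   irrelevant. Two spaces with the same V form a compatible pair, their sum
   being formed in V. *)
Record qspace (R : realType) (V : zmodType) := QSpace {
  qcar : set V;
  qnorm : V -> \bar R }.

Section net_space.
Context {R : realType} {n : nat}.
Local Notation mu := (lebesgue_tuple R n).
Implicit Types (M : set (set (Rn R n))) (f : Rn R n -> R).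

Definition net_integrable M f :=
  forall e, M e -> mu.-integrable e (EFin \o f).

(* $\bar f(t, M)$; it takes the value +oo when the averages are unbounded *)
Definition net_average M f (t : R) : \bar R :=
  ereal_sup [set ((fine (mu e))^-1 * `| \int[mu]_(x in e) f x |)%:E
            | e in [set e | M e /\ (t%:E <= mu e)%E]].

(* [p^-1] is 0 for [p = +oo] *)
Definition net_norm M (p q : \bar R) f : \bar R :=
  mellin_norm q (fun t => (t `^ fine p^-1)%:E * net_average M f t)%E.

(* Both conditions and the quasi-norm only depend on integrals of the
   representative, hence not on its choice in the a.e. class. *)
Definition net_space M (p q : \bar R) : qspace R (L0 mu) := {|
  qcar := [set a | net_integrable M (L0_repr a) /\
                   (net_norm M p q (L0_repr a) < +oo)%E];
  qnorm := fun a => net_norm M p q (L0_repr a) |}.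

End net_space.

Section real_interpolation.
Context {R : realType} {V : zmodType}.

Definition sum_space (A0 A1 : qspace R V) : set V :=
  [set a | exists a0 a1, [/\ qcar A0 a0, qcar A1 a1 & a = a0 + a1]].

Definition peetreK (A0 A1 : qspace R V) (t : R) (a : V) : \bar R :=
  ereal_inf [set x | exists a0 a1,
    [/\ qcar A0 a0, qcar A1 a1, a = a0 + a1
      & x = (qnorm A0 a0 + t%:E * qnorm A1 a1)%E]].

Definition interp_norm (A0 A1 : qspace R V) (theta : R) (q : \bar R) (a : V) :
    \bar R :=
  mellin_norm q (fun t => (t `^ (- theta))%:E * peetreK A0 A1 t a)%E.

Definition real_interp (A0 A1 : qspace R V) (theta : R) (q : \bar R) :
    qspace R V := {|
  qcar := [set a | sum_space A0 A1 a /\ (interp_norm A0 A1 theta q a < +oo)%E];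
  qnorm := interp_norm A0 A1 theta q |}.

(* equality of spaces in the sense of interpolation theory: same elements,
   equivalent quasi-norms *)
Definition same_qspace (X Y : qspace R V) : Prop :=
  qcar X = qcar Y /\
  exists c C : R, [/\ 0 < c, 0 < C & forall a, qcar X a ->
    (c%:E * qnorm X a <= qnorm Y a <= C%:E * qnorm X a)%E].

End real_interpolation.

(* Main.v *)
From HB Require Import structures.
Require Import Defs.
From mathcomp Require Import all_boot all_order all_algebra.
From mathcomp Require Import all_classical all_reals all_analysis.
From mathcomp Require Import measurable_realfun lra ring.

(** Dyadic cubes of level m have measure 2^(-n m), so the average
    F(t) = \bar f(t, M) is constant on each block (2^(n(j-1)), 2^(nj)], and the
    net quasi-norm of f is equivalent to the l^q quasi-norm of the sequence
    2^(nj/p) F(2^(nj)), j in Z. Since K is nondecreasing and K(t)/t is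
    nonincreasing in t, the interpolation quasi-norm is likewise equivalent to
    the l^q quasi-norm of 2^(-h theta j) K(2^(hj)) with h = n (1/p0 - 1/p1)
    ([net_norm_equiv], [interp_norm_equiv]). The theorem compares these two
    sequences.

    Lower bound for K. The averages are subadditive in f, and each term of a
    sequence is at most its l^q quasi-norm; so if f = f0 + f1, then
    2^(nj/p0) F(2^(nj)) is at most a constant times
    |f0|_(p0,q0) + 2^(hj) |f1|_(p1,q1), which is
    [net_seq_le_peetreK]. The choice of p turns this into a termwise bound.

    Upper bound for K. At scale 2^(nj), split f = (f - g) + g where g is the
    conditional expectation of f on the cubes of measure 2^(nj). On larger
    cubes f - g has integral zero; on smaller ones g has the average of f over
    the cube of measure 2^(nj) around them. Hence the averages of f - g are at
    most 2 F on scales up to 2^(nj) and vanish above, and those of g are at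
    most F(max(., 2^(nj))) ([net_decomposition]). Both sequences decay
    geometrically away from j in terms of x_i = 2^(ni/p) F(2^(ni)): if
    x_i <= 2^(d|i-j|) S for some small d and all i, then
    K(2^(hj)) <= C 2^(h theta j) S, whatever q0 and q1 are ([net_splitting]).

    A Hardy inequality is avoided by the choice
    S = S_j = |i |-> 2^(-d|i|) x_(i+j)|_(l^q): by Tonelli the l^q quasi-norm of
    j |-> S_j is at most a constant times that of x ([lq_conv]), for every
    q > 0, the range q < 1 included. *)

Set Implicit Arguments.
Unset Strict Implicit.
Unset Printing Implicit Defensive.

Import Order.TTheory GRing.Theory Num.Theory.

Local Open Scope classical_set_scope.
Local Open Scope ring_scope.


(** * Sequence quasi-norms over the integers *)

Section lq.
Context {R : realType}.
Implicit Types (q : \bar R) (x y : int -> \bar R).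
Local Open Scope ereal_scope.

Definition lq q x : \bar R :=
  match q with
  | r%:E => (\esum_(k in [set: int]) x k `^ r) `^ r^-1
  | +oo => ereal_sup (range x)
  | -oo => 0
  end.

Lemma lee_poweR (r : R) (a b : \bar R) : (0 <= r)%R -> 0 <= a -> a <= b ->
  a `^ r <= b `^ r.
Proof.
move=> r0 a0 ab; apply: gt0_ler_poweR => //; rewrite in_itv /= leey andbT//.
exact: le_trans ab.
Qed.

Lemma poweRrK (r : R) (a : \bar R) : r != 0%R -> 0 <= a -> (a `^ r) `^ r^-1 = a.
Proof. by move=> r0 a0; rewrite -poweRrM divff// poweRe1. Qed.

Lemma poweRVrK (r : R) (a : \bar R) : r != 0%R -> 0 <= a ->
  (a `^ r^-1) `^ r = a.
Proof. by move=> r0 a0; rewrite -poweRrM mulVf// poweRe1. Qed.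

Lemma esum_ge_term (I : choiceType) (x : I -> \bar R) k :
  (forall i, 0 <= x i) -> x k <= \esum_(i in [set: I]) x i.
Proof.
move=> x0; apply: esum_ge; exists [set k]; last by rewrite fsbig_set1.
by split => //; exact: finite_set1.
Qed.

Lemma esumZl (I : choiceType) (c : R) (x : I -> \bar R) :
  (0 <= c)%R -> (forall i, 0 <= x i) ->
  \esum_(i in [set: I]) (c%:E * x i) = c%:E * \esum_(i in [set: I]) x i.
Proof.
move=> c0 x0; rewrite /esum -ereal_supZl//; last first.
  by apply/set0P; exists 0, set0; [exact: fsets_set0|rewrite fsbig_set0].
congr ereal_sup; apply/seteqP; split.
  move=> _ [A [finA _] <-].
  exists (\sum_(i \in A) x i); first by exists A.
  by rewrite ge0_mule_fsumr.
move=> _ [_ [A [finA _] <-] <-].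
by exists A => //; rewrite ge0_mule_fsumr.
Qed.

Lemma esumZr (I : choiceType) (w : I -> \bar R) (c : \bar R) :
  0 <= c -> (forall i, 0 <= w i) ->
  \esum_(i in [set: I]) (w i * c) = (\esum_(i in [set: I]) w i) * c.
Proof.
move=> + w0; case: c => [c c0|_|//].
  by rewrite [RHS]muleC -esumZl//; apply: eq_esum => i _; exact: muleC.
have [w00|] := eqVneq (\esum_(i in [set: I]) w i) 0.
  rewrite w00 mul0e esum1// => i _.
  suff -> : w i = 0 by rewrite mul0e.
  by apply: le_anti; rewrite w0 andbT -w00; exact: esum_ge_term.
rewrite neq_lt ltNge esum_ge0//= => wgt0.
rewrite gt0_muley//; apply/eqP; rewrite -leye_eq.
have /existsNP[i wi] : ~ forall i, w i = 0.
  by move=> H; move: wgt0; rewrite esum1 ?ltxx.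
apply: le_trans (@esum_ge_term _ (fun j => w j * +oo) i _).
  by rewrite gt0_muley// lt_neqAle w0 andbT eq_sym; apply/eqP.
by move=> j; rewrite mule_ge0// leey.
Qed.

Lemma lq_term q x k : 0 < q -> (forall k, 0 <= x k) -> x k <= lq q x.
Proof.
case: q => [r| |]//; last by move=> _ x0; apply: ereal_sup_ubound; exists k.
rewrite lte_fin => r0 x0 /=; have rn0 : r != 0%R by rewrite gt_eqF.
rewrite -[leLHS](@poweRrK r)//; apply: lee_poweR; rewrite ?poweR_ge0//.
  by rewrite invr_ge0 ltW.
by apply: (@esum_ge_term _ (fun k => x k `^ r)) => i; exact: poweR_ge0.
Qed.

Lemma lq_ge0 q x : 0 < q -> (forall k, 0 <= x k) -> 0 <= lq q x.
Proof. by move=> q0 x0; apply: le_trans (lq_term 0%R q0 x0). Qed.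

Lemma le_lq q x y : 0 < q -> (forall k, 0 <= x k) -> (forall k, x k <= y k) ->
  lq q x <= lq q y.
Proof.
case: q => [r| |]// => [|_ _ xy]; last first.
  by apply: ge_ereal_sup => _ [k _ <-]; apply: le_ereal_sup_tmp; exists (y k).
rewrite lte_fin => r0 x0 xy /=; apply: lee_poweR; first by rewrite invr_ge0 ltW.
  by apply: esum_ge0 => *; exact: poweR_ge0.
by apply: le_esum => i _; apply: lee_poweR => //; rewrite ltW.
Qed.

Lemma lqZ q x (c : R) : 0 < q -> (0 <= c)%R -> (forall k, 0 <= x k) ->
  lq q (fun k => c%:E * x k) = c%:E * lq q x.
Proof.
case: q => [r| |]// => [|_ c0 x0]; last first.
  rewrite /= -ereal_supZl//; last by apply/set0P; exists (x 0%R), 0%R.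
  congr ereal_sup; apply/seteqP; split => [_ [k _ <-]|_ [_ [k _ <-] <-]].
    by exists (x k) => //; exists k.
  by exists k.
rewrite lte_fin => r0 c0 x0 /=.
have rn0 : r != 0%R by rewrite gt_eqF.
under eq_esum do rewrite poweRM// poweR_EFin.
rewrite esumZl ?powR_ge0//; last by move=> i; exact: poweR_ge0.
rewrite poweRM ?lee_fin ?powR_ge0//; last first.
  by apply: esum_ge0 => *; exact: poweR_ge0.
by rewrite -poweR_EFin poweRrK.
Qed.

Lemma esum_shift (x : int -> \bar R) j :
  \esum_(k in [set: int]) x (k + j)%R = \esum_(k in [set: int]) x k.
Proof.
rewrite [RHS](reindex_esum setT _ (fun k => k + j)%R)//; split=> //.
  by move=> a b _ _; exact: addIr.
by move=> a _; exists (a - j)%R => //; rewrite subrK.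
Qed.

Lemma lq_shift q x j : lq q (fun k => x (k + j)%R) = lq q x.
Proof.
case: q => [r| |]//=.
  by rewrite (esum_shift (fun k => x k `^ r)).
congr ereal_sup; apply/seteqP; split => [_ [k _ <-]|_ [k _ <-]].
  by exists (k + j)%R.
by exists (k - j)%R => //; rewrite subrK.
Qed.

Lemma esum_exchange (I J : choiceType) (a : I -> J -> \bar R) :
  (forall i j, 0 <= a i j) ->
  \esum_(i in [set: I]) \esum_(j in [set: J]) a i j =
  \esum_(j in [set: J]) \esum_(i in [set: I]) a i j.
Proof.
move=> a0; rewrite !esum_esum//.
rewrite (reindex_esum ([set: J] `*` [set: I]) _ (fun ij => (ij.2, ij.1))).
  by [].
split=> //=.
  by move=> [i1 i2] [j1 j2] /= _ _ [] -> ->.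
by move=> [i1 i2] _ /=; exists (i2, i1).
Qed.

(** In l^q with q finite, both sides are equal, by Tonelli and by invariance
    under shifts. Taking the inner quasi-norm to be l^q with the same q is what
    makes the exchange possible for every q > 0. *)
Lemma lq_conv q (w : int -> R) x : 0 < q -> (forall j, 0 <= w j)%R ->
  (forall k, 0 <= x k) ->
  lq q (fun k => lq q (fun j => (w j)%:E * x (k + j)%R)) <=
  lq q (fun j => (w j)%:E) * lq q x.
Proof.
move=> q0 w0 x0; have wx0 k j : 0 <= (w j)%:E * x k by rewrite mule_ge0// lee_fin.
case: q q0 => [r| |]// => [|_]; last first.
  apply: ge_ereal_sup => _ [k _ <-]; apply: ge_ereal_sup => _ [j _ <-].
  by apply: lee_pmul; rewrite ?lee_fin//; [apply: (@lq_term +oo (EFin \o w))|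
    apply: (@lq_term +oo)].
rewrite lte_fin => r0 /=; have rn0 : r != 0%R by rewrite gt_eqF.
rewrite (@eq_esum _ _ _ _ (fun k =>
    \esum_(j in [set: int]) ((w j)%:E * x (k + j)%R) `^ r)); last first.
  move=> k _; rewrite poweRVrK//; apply: esum_ge0 => *; exact: poweR_ge0.
rewrite esum_exchange; last by move=> *; exact: poweR_ge0.
rewrite -poweRM; last 2 first.
- by apply: esum_ge0 => *; rewrite lee_fin powR_ge0.
- by apply: esum_ge0 => *; exact: poweR_ge0.
rewrite le_eqVlt; apply/orP; left; apply/eqP; congr (_ `^ _).
rewrite (@eq_esum _ _ _ _ (fun j =>
    (w j `^ r)%:E * \esum_(k in [set: int]) x k `^ r)); last first.
  move=> j _; rewrite (esum_shift (fun k => ((w j)%:E * x k) `^ r)).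
  under eq_esum do rewrite poweRM ?lee_fin// poweR_EFin.
  by rewrite esumZl ?powR_ge0// => *; exact: poweR_ge0.
by apply: esumZr => *; rewrite ?lee_fin ?powR_ge0//; apply: esum_ge0 => *;
  exact: poweR_ge0.
Qed.

End lq.


(** * Powers of two and geometric weights *)

Section pow2.
Context {R : realType}.
Implicit Types r s t : R.

Lemma pow2_gt0 r : 0 < (2 : R) `^ r. Proof. exact: powR_gt0. Qed.

Lemma pow2D r s : (2 : R) `^ (r + s) = 2 `^ r * 2 `^ s.
Proof. by rewrite powRD// pnatr_eq0 implybT. Qed.

Lemma ler_pow2 r s : ((2 : R) `^ r <= 2 `^ s) = (r <= s).
Proof.
by rewrite /powR pnatr_eq0/= ler_expR ler_pM2r// ln_gt0// ltr1n.
Qed.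

Lemma ltr_pow2 r s : ((2 : R) `^ r < 2 `^ s) = (r < s).
Proof. by rewrite !ltNge ler_pow2. Qed.

Lemma pow2_log t : 0 < t -> t = 2 `^ (ln t / ln 2).
Proof.
move=> t0; rewrite /powR pnatr_eq0/= divfK ?lnK ?posrE//.
by rewrite gt_eqF// ln_gt0// ltr1n.
Qed.

End pow2.

Section geo.
Context {R : realType}.
Local Open Scope ereal_scope.

Lemma nneseries_geometric_lty (a : R) : (0 <= a)%R -> (a < 1)%R ->
  \sum_(k <oo) (a ^+ k)%:E < +oo.
Proof.
move=> a0 a1; apply: (@le_lt_trans _ _ ((1 - a)^-1)%:E); last exact: ltry.
apply: lime_le.
  by apply: is_cvg_nneseries => k _ _; rewrite lee_fin exprn_ge0.
apply: nearW => k; rewrite sumEFin lee_fin.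
have a10 : (0 < 1 - a)%R by rewrite subr_gt0.
rewrite -[leRHS]mul1r ler_pdivlMr// mulrC.
suff -> : ((1 - a) * \sum_(0 <= i < k) a ^+ i = 1 - a ^+ k)%R.
  by rewrite lerBlDr lerDl exprn_ge0.
elim: k => [|k ih]; first by rewrite big_geq// mulr0 expr0 subrr.
by rewrite big_nat_recr//= mulrDr ih exprS; ring.
Qed.

Definition geo (d : R) (j : int) : R := (2 `^ (- (d * `|j%:~R|)))%R.

Lemma geo_ge0 d j : (0 <= geo d j)%R. Proof. exact: powR_ge0. Qed.

Lemma esum_geo_lty d : (0 < d)%R -> \esum_(j in [set: int]) (geo d j)%:E < +oo.
Proof.
move=> d0; have g0 j : 0 <= (geo d j)%:E by rewrite lee_fin geo_ge0.
pose a : R := (2 `^ (- d))%R.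
have a0 : (0 <= a)%R by exact: powR_ge0.
have a1 : (a < 1)%R by rewrite /a -[ltRHS](powRr0 2) ltr_pow2 oppr_lt0.
have gE j : geo d j = (a ^+ `|j|)%R.
  rewrite /geo -(powR_mulrn _ a0) -powRrM; congr (_ `^ _)%R.
  by rewrite -intr_norm natr_absz mulNr.
rewrite (esumID (range Posz))//.
rewrite !setTI.
have -> : ~` range Posz = range Negz.
  apply/seteqP; split => [[k|k] /=|_ [k _ <-] [j _]//].
    by move=> nk; exfalso; apply: nk; exists k.
  by move=> _; exists k.
rewrite !esum_image//; try by move=> ? ? _ _ [].
under eq_esum do rewrite gE; under [X in _ + X]eq_esum do rewrite gE /=.
rewrite -!nneseries_esumT; try by move=> *; rewrite lee_fin exprn_ge0.
apply: lte_add_pinfty; first exact: nneseries_geometric_lty.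
apply: le_lt_trans (nneseries_geometric_lty a0 a1).
apply: lee_nneseries => k _; first by rewrite lee_fin exprn_ge0.
by rewrite lee_fin exprS ger_pMl ?exprn_gt0// ?powR_gt0// ltW.
Qed.

Lemma lq_geo_lty (q : \bar R) d : 0 < q -> (0 < d)%R ->
  lq q (fun j => (geo d j)%:E) < +oo.
Proof.
case: q => [r| |]// q0 d0 /=; last first.
  apply: (@le_lt_trans _ _ 1); last exact: ltry.
  apply: ge_ereal_sup => _ [j _ <-]; rewrite lee_fin /geo -[leRHS](powRr0 2).
  by rewrite ler_pow2 oppr_le0 mulr_ge0// ltW.
apply: poweR_lty; rewrite lte_fin in q0.
apply: le_lt_trans (esum_geo_lty (mulr_gt0 d0 q0)).
apply: le_esum => j _; rewrite lee_fin /geo -powRrM ler_pow2.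
by rewrite mulNr mulrAC.
Qed.

End geo.

(** * Integrals along countable partitions *)

Section countable_fibers.
Context d (T : measurableType d) (R : realType) (I : countType).
Variables (D : set T) (kap : T -> I).
Hypotheses (mD : measurable D)
  (mkap : forall i, measurable (D `&` kap @^-1` [set i])).

Lemma measurable_fun_countable_fibers d' (T' : measurableType d') (w : I -> T') :
  measurable_fun D (w \o kap).
Proof.
move=> _ Y mY.
rewrite (_ : D `&` _ =
  \bigcup_i (if w i \in Y then D `&` kap @^-1` [set i] else set0)).
  apply: countable_bigcupT_measurable => // i.
  by case: ifPn.
apply/seteqP; split => [x [Dx Yx]|x [i _]].
  by exists (kap x) => //; rewrite mem_set.
by case: ifPn => // /set_mem Yi [Dx /= kx]; split=> //=; rewrite kx.
Qed.

(** [pickle_inv] rather than [unpickle]: the latter is not injective on its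
    domain, and fibers would be repeated. *)
Definition fiber_seq (m : nat) : set T :=
  if pickle_inv m is Some i then D `&` kap @^-1` [set i] else set0.

Lemma fiber_seq_cover : \bigcup_m fiber_seq m = D.
Proof.
apply/seteqP; split => [x [m _]|x Dx].
  by rewrite /fiber_seq; case: (pickle_inv m) => // i [].
by exists (pickle (kap x)) => //; rewrite /fiber_seq pickleK_inv.
Qed.

Lemma measurable_fiber_seq m : measurable (fiber_seq m).
Proof. by rewrite /fiber_seq; case: (pickle_inv m). Qed.

Lemma trivIset_fiber_seq : trivIset setT fiber_seq.
Proof.
move=> m m' _ _ [x []]; rewrite /fiber_seq.
case Em: (pickle_inv m) => [i|]// [_ /= ki].
case Em': (pickle_inv m') => [j|]// [_ /= kj].
move: (@pickle_invK I m) (@pickle_invK I m'); rewrite Em Em' /= => <- <-.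
by rewrite -ki -kj.
Qed.

Local Open Scope ereal_scope.
Variable mu : {measure set T -> \bar R}.

(** Comparing integrals of absolute values fiber by fiber is enough, since both
    sum to integrals over D. *)
Lemma integrable_countable_fibers (f g : T -> \bar R) :
  mu.-integrable D f -> measurable_fun D g ->
  (forall i, \int[mu]_(x in D `&` kap @^-1` [set i]) `|g x| <=
             \int[mu]_(x in D `&` kap @^-1` [set i]) `|f x|) ->
  mu.-integrable D g.
Proof.
move=> /integrableP[mf fi] mg gf; apply/integrableP; split => //.
apply: le_lt_trans fi; rewrite -fiber_seq_cover.
have mF := measurable_fiber_seq.
rewrite !ge0_integral_bigcup//; try exact: trivIset_fiber_seq.
- apply: lee_nneseries => [m _ _|m _]; first exact: integral_ge0.
  rewrite /fiber_seq; case: (pickle_inv m) => //.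
  by rewrite !integral_set0.
- by rewrite fiber_seq_cover; exact: measurableT_comp.
- by rewrite fiber_seq_cover; exact: measurableT_comp.
Qed.

Lemma eq_integral_countable_fibers (f g : T -> \bar R) :
  mu.-integrable D f -> mu.-integrable D g ->
  (forall i, \int[mu]_(x in D `&` kap @^-1` [set i]) f x =
             \int[mu]_(x in D `&` kap @^-1` [set i]) g x) ->
  \int[mu]_(x in D) f x = \int[mu]_(x in D) g x.
Proof.
move=> fi gi fg; rewrite -fiber_seq_cover in fi gi *.
rewrite !integral_bigcup//; try exact: trivIset_fiber_seq;
  try exact: measurable_fiber_seq.
apply: eq_eseriesr => m _; rewrite /fiber_seq; case: (pickle_inv m) => //.
by rewrite !integral_set0.
Qed.

Lemma integral_countable_fibers (w : I -> \bar R) : (forall i, 0 <= w i) ->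
  \int[mu]_(x in D) w (kap x) =
  \esum_(i in [set: I]) (w i * mu (D `&` kap @^-1` [set i])).
Proof.
move=> w0; rewrite -{1}fiber_seq_cover ge0_integral_bigcup//; last 3 first.
- exact: measurable_fiber_seq.
- by rewrite fiber_seq_cover; exact: measurable_fun_countable_fibers.
- exact: trivIset_fiber_seq.
pose g n := if pickle_inv n is Some i then w i * mu (D `&` kap @^-1` [set i])
            else 0.
have g0 n : 0 <= g n.
  by rewrite /g; case: (pickle_inv n) => // i; rewrite mule_ge0.
rewrite (@eq_eseriesr _ _ g); last first.
  move=> n _; rewrite /fiber_seq /g; case: (pickle_inv n) => [i|]; last first.
    by rewrite integral_set0.
  rewrite -integral_cst//; apply: eq_integral => x /set_mem[_ /= ->] //.
rewrite nneseries_esumT//.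
transitivity (\esum_(n in range (@pickle I)) g n).
  rewrite [RHS]esum_mkcond; apply: eq_esum => n _.
  rewrite /g; case: ifPn => //; rewrite notin_setE => nr.
  case E : (pickle_inv n) => [i|//]; exfalso; apply: nr; exists i => //.
  by move: (@pickle_invK I n); rewrite E.
rewrite esum_image; last by move=> i j _ _; exact: (pcan_inj pickleK).
by apply: eq_esum => i _; rewrite /g pickleK_inv.
Qed.

End countable_fibers.

(** * Discretization of the Mellin quasi-norm *)

Section monotone_integral.
Context {R : realType}.
Local Open Scope ereal_scope.

(** The integral of a nonnegative function is a supremum over simple functions
    below it, hence monotone without any measurability. Thus [phi] may be
    any nonnegative function in the two comparisons below, where only step
    functions are integrated explicitly. *)
Lemma ge0_le_integral_nonmeas d (T : measurableType d)
    (mu : {measure set T -> \bar R}) (D : set T) (f g : T -> \bar R) :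
  (forall x, D x -> 0 <= f x) -> (forall x, D x -> f x <= g x) ->
  \int[mu]_(x in D) f x <= \int[mu]_(x in D) g x.
Proof.
move=> f0 fg; rewrite !ge0_integralE//; last first.
  by move=> x Dx; apply: le_trans (fg x Dx); exact: f0.
apply: ereal_sup_le => _ [G Gf <-]; exists G => //= x.
by apply: le_trans (Gf x) _; exact: lee_restrict.
Qed.

End monotone_integral.

Section mellin_blocks.
Context {R : realType}.
Variables (h : R) (h0 : 0 < h).

Definition block (k : int) : set R :=
  `]2 `^ (h * (k%:~R - 1)), 2 `^ (h * k%:~R)]%classic.

Lemma block_log k t : block k t ->
  exists u, [/\ t = 2 `^ u, h * (k%:~R - 1) < u & u <= h * k%:~R].
Proof.
rewrite /block /= in_itv/= => /andP[tl tr].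
have tE : t = 2 `^ (ln t / ln 2).
  by apply: pow2_log; apply: lt_trans tl; exact: pow2_gt0.
by exists (ln t / ln 2); move: tl tr; rewrite {1 2}tE ltr_pow2 ler_pow2.
Qed.

(* kap t is the index of the block that contains t > 0. *)
Let kap (t : measurableTypeR R) : int := Num.ceil (ln t / ln 2 / h).

Let kapE k : `]0, +oo[%classic `&` kap @^-1` [set k] = block k.
Proof.
have E t : 0 < t -> (kap t == k) =
    (2 `^ (h * (k%:~R - 1)) < t <= 2 `^ (h * k%:~R)).
  move=> t0; rewrite /kap ceil_eq [in RHS](pow2_log t0) ltr_pow2 ler_pow2.
  by rewrite ltr_pdivlMr// ler_pdivrMr// rmorphB/= !(mulrC h).
apply/seteqP; split => t; rewrite /block /= !in_itv/= andbT.
  by move=> [t0 /eqP]; rewrite E.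
move=> tk; have t0 : 0 < t.
  by case/andP : tk => + _; apply: lt_trans; exact: pow2_gt0.
by split=> //; apply/eqP; rewrite E.
Qed.

Let mkap k : measurable (`]0, +oo[%classic `&` kap @^-1` [set k]).
Proof. by rewrite kapE; exact: measurable_itv. Qed.

Local Open Scope ereal_scope.

Let mu_block k : lebesgue_measure (block k) = 
  (2 `^ (h * k%:~R) * (1 - 2 `^ (- h)))%:E.
Proof.
rewrite /block lebesgue_measure_itv/= lte_fin ltr_pow2 ltr_pM2l// ltrBlDr ltrDl.
rewrite ltr01 -EFinB; congr (_%:E).
rewrite [RHS]mulrBr mulr1 -pow2D; congr (_ - 2 `^ _)%R; ring.
Qed.

(* The factor 2^(s - h kap t) stands for 1/t, which lies between its values for
   s = 0 and s = h. *)
Let integral_blocks (y : int -> \bar R) s : (forall k, 0 <= y k) ->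
  \int[lebesgue_measure]_(t in `]0%R, +oo[)
     (y (kap t) * (2 `^ (s - h * (kap t)%:~R))%:E) =
  (2 `^ s * (1 - 2 `^ (- h)))%:E * \esum_(k in [set: int]) y k.
Proof.
move=> y0; set w := fun k => y k * (2 `^ (s - h * k%:~R))%:E.
have h1 : (0 <= 1 - 2 `^ (- h))%R.
  by rewrite subr_ge0 -[leRHS](powRr0 2) ler_pow2 oppr_le0 ltW.
rewrite (@integral_countable_fibers _ _ _ _ _ kap mkap lebesgue_measure w)//.
- rewrite -esumZl//; last by rewrite mulr_ge0// powR_ge0.
  apply: eq_esum => k _; rewrite kapE.
  rewrite [X in _ * X = _](mu_block k) /w -muleA muleC; congr (_ * _).
  rewrite -EFinM mulrA -pow2D; congr (2 `^ _ * _)%:E; ring.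
- by move=> k; rewrite mule_ge0// lee_fin powR_ge0.
Qed.

Let kap_block (t : R) : (0 < t)%R -> block (kap t) t.
Proof. by move=> t0; rewrite -kapE; split=> //=; rewrite in_itv/= t0. Qed.

(** Each block has finite positive mass for dt/t, the same for all blocks, so
    bounds of [phi] on the blocks pass to the quasi-norms. *)
Lemma mellin_norm_le_lq q : 0 < q -> exists2 C : R, (0 < C)%R &
  forall (phi : R -> \bar R) (x : int -> \bar R),
    (forall t, (0 < t)%R -> 0 <= phi t) ->
    (forall k t, block k t -> phi t <= x k) ->
    (forall k, 0 <= x k) ->
  mellin_norm q phi <= C%:E * lq q x.
Proof.
case: q => [r| |]//; last first.
  move=> _; exists 1%R => // phi x phi0 phix x0; rewrite mul1e.
  apply: ge_ereal_sup => _ [t /= + <-]; rewrite in_itv/= andbT => t0.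
  apply: le_trans (phix _ _ (kap_block t0)) _.
  by apply: ereal_sup_ubound; exists (kap t).
rewrite lte_fin => r0; have rn0 : r != 0%R by rewrite gt_eqF.
have h1 : (0 < 1 - 2 `^ (- h))%R.
  by rewrite subr_gt0 -[ltRHS](powRr0 2) ltr_pow2 oppr_lt0.
pose c : R := (2 `^ h * (1 - 2 `^ (- h)))%R.
have c0 : (0 < c)%R by rewrite mulr_gt0// pow2_gt0.
exists (c `^ r^-1)%R; first exact: powR_gt0.
move=> phi x phi0 phix x0 /=.
rewrite -poweR_EFin -poweRM; last 2 first.
- by rewrite lee_fin ltW.
- by apply: esum_ge0 => *; exact: poweR_ge0.
apply: lee_poweR; first by rewrite invr_ge0 ltW.
  apply: integral_ge0 => t; rewrite /= in_itv/= andbT => t0.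
  by rewrite mule_ge0 ?poweR_ge0// lee_fin invr_ge0 ltW.
rewrite /c -(@integral_blocks (fun k => x k `^ r)); last first.
  by move=> *; exact: poweR_ge0.
apply: ge0_le_integral_nonmeas => t; rewrite /= in_itv/= andbT => t0.
  by rewrite mule_ge0 ?poweR_ge0// lee_fin invr_ge0 ltW.
have := kap_block t0; rewrite /block /= in_itv/= => /andP[tl tr].
apply: lee_pmul; rewrite ?poweR_ge0//.
- by rewrite lee_fin invr_ge0 ltW.
- by apply: lee_poweR; [exact: ltW|exact: phi0|apply: phix; exact: kap_block].
- rewrite lee_fin -[leRHS]invrK -powRN lef_pV2 ?posrE// ?pow2_gt0//.
  apply/ltW; apply: le_lt_trans tl; by rewrite ler_pow2 opprB mulrBr mulr1.
Qed.

Lemma lq_le_mellin_norm q : 0 < q -> exists2 C : R, (0 < C)%R &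
  forall (phi : R -> \bar R) (x : int -> \bar R),
    (forall k t, block k t -> x k <= phi t) ->
    (forall k, 0 <= x k) ->
  lq q x <= C%:E * mellin_norm q phi.
Proof.
case: q => [r| |]//; last first.
  move=> _; exists 1%R => // phi x phix x0; rewrite mul1e.
  apply: ge_ereal_sup => _ [k _ <-].
  apply: le_ereal_sup_tmp; exists (phi (2 `^ (h * k%:~R))%R).
    by exists (2 `^ (h * k%:~R))%R => //=; rewrite in_itv/= pow2_gt0.
  apply: phix; rewrite /block /= in_itv/= lexx andbT ltr_pow2 ltr_pM2l//.
  by rewrite ltrBlDr ltrDl.
rewrite lte_fin => r0; have rn0 : r != 0%R by rewrite gt_eqF.
pose c : R := (1 - 2 `^ (- h))%R.
have c0 : (0 < c)%R.
  by rewrite subr_gt0 -[ltRHS](powRr0 2) ltr_pow2 oppr_lt0.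
exists (c^-1 `^ r^-1)%R; first by rewrite powR_gt0// invr_gt0.
move=> phi x phix x0 /=.
have phi0 t : (0 < t)%R -> 0 <= phi t.
  by move=> t0; apply: le_trans (phix _ _ (kap_block t0)).
have i0 : 0 <= \int[lebesgue_measure]_(t in `]0%R, +oo[)
               (phi t `^ r * (t^-1)%:E).
  apply: integral_ge0 => t; rewrite /= in_itv/= andbT => t0.
  by rewrite mule_ge0 ?poweR_ge0// lee_fin invr_ge0 ltW.
rewrite -poweR_EFin -poweRM//; last by rewrite lee_fin invr_ge0 ltW.
apply: lee_poweR; first by rewrite invr_ge0 ltW.
  by apply: esum_ge0 => *; exact: poweR_ge0.
rewrite muleC lee_pdivlMr// muleC.
have := @integral_blocks (fun k => x k `^ r) 0%R.
rewrite powRr0 mul1r => <-; last by move=> *; exact: poweR_ge0.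
apply: ge0_le_integral_nonmeas => t; rewrite /= in_itv/= andbT => t0.
  by rewrite mule_ge0 ?poweR_ge0// lee_fin powR_ge0.
have := kap_block t0; rewrite /block /= in_itv/= => /andP[tl tr].
apply: lee_pmul; rewrite ?poweR_ge0//.
- by apply: lee_poweR; [exact: ltW| |apply: phix; exact: kap_block].
- by rewrite lee_fin sub0r powRN lef_pV2 ?posrE// ?pow2_gt0.
Qed.

End mellin_blocks.


(** * Dyadic cubes *)

Section cubes.
Context {R : realType} {n : nat}.
Local Notation mu := (lebesgue_tuple R n).
Implicit Types (m : int) (k : 'I_n -> int) (x y : Rn R n).

Definition cube_index m x : {ffun 'I_n -> int} :=
  [ffun i => Num.floor (tnth x i * 2 ^ m)].

Lemma dyadic_cubeP m k x : dyadic_cube m k x <-> cube_index m x =1 k.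
Proof.
have m0 : 0 < (2 : R) ^ m by rewrite exprz_gt0.
split => H i; have := H i; rewrite ffunE.
  by rewrite ler_pdivrMr// ltr_pdivlMr// -floor_eq => /eqP.
by move/eqP; rewrite floor_eq -ler_pdivrMr// -ltr_pdivlMr.
Qed.

Lemma dyadic_cube_preimage m (k : {ffun 'I_n -> int}) :
  dyadic_cube m k = cube_index m @^-1` [set k] :> set (Rn R n).
Proof.
apply/seteqP; split => x; first by move/dyadic_cubeP/ffunP.
by move=> /= kE; apply/dyadic_cubeP => i; rewrite kE.
Qed.

Lemma measurable_dyadic_cube m k : measurable (dyadic_cube m k : set (Rn R n)).
Proof.
rewrite (_ : dyadic_cube _ _ = \bigcap_(i in [set: 'I_n])
     ((@tnth _ _)^~ i @^-1` `[(k i)%:~R / 2 ^ m, (k i + 1)%:~R / 2 ^ m[%classic)).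
  apply: fin_bigcap_measurable => // i _; rewrite -[X in measurable X]setTI.
  exact: measurable_tnth.
apply/seteqP; split=> x Bx i => [_|]; first by rewrite /= in_itv/=; exact: Bx.
by have := Bx i I; rewrite /= in_itv.
Qed.

Lemma dyadic_cube_nonempty m k : exists x : Rn R n, dyadic_cube m k x.
Proof.
exists [tuple (k i)%:~R / 2 ^ m | i < n] => i.
by rewrite tnth_mktuple lexx ltr_pM2r ?invr_gt0 ?exprz_gt0//= ltr_int ltrDl.
Qed.

(** Nestedness of the dyadic cubes: at a coarser level m, the condition
    j <= floor(2^m x) is a condition j 2^d <= floor(2^(m+d) x) on the finer
    index. *)
Lemma cube_index_coarsen m m' x y : m <= m' ->
  cube_index m' x = cube_index m' y -> cube_index m x = cube_index m y.
Proof.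
move=> mm' xy; apply/ffunP => i; rewrite !ffunE.
have {xy} : Num.floor (tnth x i * 2 ^ m') = Num.floor (tnth y i * 2 ^ m').
  by move/ffunP : xy => /(_ i); rewrite !ffunE.
have [d ->] : exists d : nat, m' = m + d%:Z.
  by exists `|m' - m|%N; rewrite gez0_abs ?subr_ge0// subrKC.
have H (a : R) (j : int) :
    (j <= Num.floor (a * 2 ^ m)) =
    (j * 2 ^+ d <= Num.floor (a * 2 ^ (m + d%:Z))).
  rewrite !floor_ge_int rmorphM rmorphXn/= expfzDr ?pnatr_eq0// mulrA.
  by rewrite ler_pM2r// exprn_gt0.
move=> E; apply/le_anti/andP.
by split; rewrite H; [rewrite -E|rewrite E]; rewrite -H.
Qed.

Lemma mu_dyadic_cube m k : mu (dyadic_cube m k) = (2 `^ (n%:R * (- m%:~R)))%:E.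
Proof.
rewrite lebesgue_dyadic_cube; congr EFin.
by rewrite mulrC powRrM powR_mulrn ?powR_ge0// powRN powR_intmul.
Qed.

End cubes.

(** * Conditional expectation on dyadic cubes *)

Section dyadic_mean.
Context {R : realType} {n : nat}.
Local Notation mu := (lebesgue_tuple R n).
Variables (f : Rn R n -> R) (m : int).

Definition cube_mean (k : {ffun 'I_n -> int}) : R :=
  (fine (mu (dyadic_cube m k)))^-1 * \int[mu]_(x in dyadic_cube m k) f x.

Definition dyadic_mean (x : Rn R n) : R := cube_mean (cube_index m x).

Lemma measurable_dyadic_mean : measurable_fun setT dyadic_mean.
Proof.
apply: (@measurable_fun_countable_fibers _ _ _ setT (cube_index m)).
by move=> k; rewrite setTI -dyadic_cube_preimage; exact: measurable_dyadic_cube.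
Qed.

HB.instance Definition _ :=
  isMeasurableFun.Build _ _ _ _ dyadic_mean measurable_dyadic_mean.

End dyadic_mean.

Section dyadic_mean_integral.
Context {R : realType} {n : nat}.
Local Notation mu := (lebesgue_tuple R n).
Local Notation cubes := (dyadic_cubes R n).
Variables (f : Rn R n -> R) (m : int).
Hypothesis fi : net_integrable cubes f.
Local Notation g := (dyadic_mean f m).

Let Q (m : int) (k : 'I_n -> int) : set (Rn R n) := dyadic_cube m k.

Let fiQ m' k : mu.-integrable (Q m' k) (EFin \o f).
Proof. by apply: fi; exists m', k. Qed.

Local Open Scope ereal_scope.

Let integral_mean_fiber (k : {ffun 'I_n -> int}) :
  \int[mu]_(x in Q m k) (g x)%:E = \int[mu]_(x in Q m k) (f x)%:E.
Proof.
transitivity (\int[mu]_(x in Q m k) (cube_mean f m k)%:E).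
  apply: eq_integral => x; rewrite inE /Q dyadic_cube_preimage => /= xk.
  by rewrite /dyadic_mean xk.
rewrite integral_cst; last exact: measurable_dyadic_cube.
rewrite /cube_mean /Q mu_dyadic_cube/=.
rewrite [X in _ * X = _](mu_dyadic_cube m k) -EFinM mulrAC mulVf; last first.
  by rewrite gt_eqF// pow2_gt0.
rewrite mul1r fineK//; apply: integrable_fin_num => //.
exact: measurable_dyadic_cube.
Qed.

Let integral_abs_mean_fiber (k : {ffun 'I_n -> int}) :
  \int[mu]_(x in Q m k) `|(g x)%:E| <= \int[mu]_(x in Q m k) `|(f x)%:E|.
Proof.
have mQ : measurable (Q m k) by exact: measurable_dyadic_cube.
apply: le_trans (le_abse_integral mu mQ (measurable_int mu (fiQ m k))).
rewrite -integral_mean_fiber.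
rewrite (@eq_integral _ _ _ _ _ (cst `|(cube_mean f m k)%:E|)); last first.
  move=> x; rewrite inE /Q dyadic_cube_preimage => /= xk.
  by rewrite /dyadic_mean xk.
rewrite (@eq_integral _ _ _ mu _ (cst (cube_mean f m k)%:E) (EFin \o g)); last first.
  move=> x; rewrite inE /Q dyadic_cube_preimage => /= xk.
  by rewrite /dyadic_mean xk.
by rewrite !integral_cst// abseM (gee0_abs (measure_ge0 _ _)).
Qed.

(* A coarser cube is partitioned by the cubes of level m it meets, so fibers
   of the index map over it are empty or whole cubes. *)
Let fiber_cases m' k' (k : {ffun 'I_n -> int}) : (m' <= m)%R ->
  Q m' k' `&` cube_index m @^-1` [set k] = Q m k \/
  Q m' k' `&` cube_index m @^-1` [set k] = set0.
Proof.
move=> m'm; have [->|/set0P[x [Qx /= xk]]] :=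
  eqVneq (Q m' k' `&` cube_index m @^-1` [set k]) set0; first by right.
left; rewrite /Q dyadic_cube_preimage; apply/seteqP; split => y [].
  by [].
move=> yk; split => //; apply/dyadic_cubeP.
rewrite (@cube_index_coarsen _ _ m' m y x)//; last by rewrite yk xk.
exact/dyadic_cubeP.
Qed.

Let mfiber m' k' (k : {ffun 'I_n -> int}) :
  measurable (Q m' k' `&` cube_index m @^-1` [set k]).
Proof.
rewrite -dyadic_cube_preimage.
by apply: measurableI; exact: measurable_dyadic_cube.
Qed.

Lemma mean_on_cube m' k' x y : (m <= m')%R -> Q m' k' x -> Q m' k' y ->
  g y = cube_mean f m (cube_index m x).
Proof.
move=> mm' /dyadic_cubeP Qx /dyadic_cubeP Qy; rewrite /dyadic_mean.
congr cube_mean; apply: (cube_index_coarsen mm').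
by apply/ffunP => i; rewrite Qx Qy.
Qed.

(** On cubes finer than level m the mean is constant. On a coarser cube it is
    dominated fiber by fiber by the absolute value of f, because averaging
    contracts the integral of the absolute value. *)
Lemma net_integrable_dyadic_mean : net_integrable cubes g.
Proof.
move=> _ [m' [k' ->]].
have mQ : measurable (Q m' k') by exact: measurable_dyadic_cube.
have mg : measurable_fun (Q m' k') (EFin \o g).
  by apply/measurable_EFinP; apply: measurable_funTS; exact: measurable_dyadic_mean.
have [mm'|/ltW m'm] := leP m m'.
  have [x Qx] := @dyadic_cube_nonempty R n m' k'.
  apply/integrableP; split => //.
  rewrite (@eq_integral _ _ _ _ _
      (cst `|(cube_mean f m (cube_index m x))%:E|)); last first.
    by move=> y /set_mem Qy /=; rewrite (mean_on_cube mm' Qx Qy).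
  by rewrite integral_cst// [X in _ * X](mu_dyadic_cube m' k') -EFinM ltry.
apply: (integrable_countable_fibers (mfiber m' k') (fiQ m' k') mg) => k.
have [->|->] := fiber_cases k' k m'm; first exact: integral_abs_mean_fiber.
by rewrite !integral_set0.
Qed.

Lemma integral_dyadic_mean m' k' : (m' <= m)%R ->
  \int[mu]_(x in Q m' k') (g x)%:E = \int[mu]_(x in Q m' k') (f x)%:E.
Proof.
move=> m'm.
apply: (@eq_integral_countable_fibers _ _ _ _ _ _ (mfiber m' k') mu
  (EFin \o g) (EFin \o f)) => //.
  by apply: net_integrable_dyadic_mean; exists m', k'.
move=> k; have [->|->] := fiber_cases k' k m'm; first exact: integral_mean_fiber.
by rewrite !integral_set0.
Qed.

End dyadic_mean_integral.

(** * Averages over dyadic cubes *)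

Section averages.
Context {R : realType} {n : nat}.
Local Notation mu := (lebesgue_tuple R n).
Local Notation cubes := (dyadic_cubes R n).
Implicit Types (f g : Rn R n -> R) (m : int) (k : 'I_n -> int) (e : set (Rn R n)).

Definition abs_mean f e : R := (fine (mu e))^-1 * `| \int[mu]_(x in e) f x |.

Lemma abs_mean_ge0 f e : 0 <= abs_mean f e.
Proof. by rewrite mulr_ge0// invr_ge0 fine_ge0. Qed.

Lemma abs_mean_dyadic_mean_large f m m' k : net_integrable cubes f ->
  m' <= m ->
  abs_mean (dyadic_mean f m) (dyadic_cube m' k) = abs_mean f (dyadic_cube m' k).
Proof.
by move=> fi m'm; rewrite /abs_mean /Rintegral (integral_dyadic_mean fi).
Qed.

Lemma abs_mean_dyadic_mean_small f m m' k : m <= m' ->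
  exists k', abs_mean (dyadic_mean f m) (dyadic_cube m' k) =
             abs_mean f (dyadic_cube m k').
Proof.
move=> mm'; have [x Qx] := @dyadic_cube_nonempty R n m' k.
exists (cube_index m x); rewrite {1}/abs_mean.
rewrite (@eq_Rintegral _ _ _ _ _ (cst (cube_mean f m (cube_index m x)))); last first.
  by move=> y /set_mem Qy; rewrite (mean_on_cube _ mm' Qx Qy).
rewrite Rintegral_cst; last exact: measurable_dyadic_cube.
rewrite [X in `|_ * fine X|](mu_dyadic_cube m' k) mu_dyadic_cube /=.
rewrite normrM [X in _ * (_ * X)]ger0_norm ?powR_ge0//.
rewrite mulrCA mulVf ?gt_eqF ?pow2_gt0// mulr1.
by rewrite /cube_mean normrM ger0_norm// invr_ge0 fine_ge0.
Qed.

Lemma net_averageE f t : net_average cubes f t =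
  ereal_sup [set (abs_mean f e)%:E | e in [set e | cubes e /\ (t%:E <= mu e)%E]].
Proof. by []. Qed.

Local Open Scope ereal_scope.

Lemma net_average_leP f t (a : \bar R) :
  net_average cubes f t <= a <->
  (forall m k, (t <= 2 `^ (n%:R * - m%:~R))%R ->
    (abs_mean f (dyadic_cube m k))%:E <= a).
Proof.
rewrite net_averageE; split => [H m k tm|H].
  apply: le_trans H; apply: ereal_sup_ubound; exists (dyadic_cube m k) => //.
  by split; [exists m, k|rewrite mu_dyadic_cube lee_fin].
apply: ge_ereal_sup => _ [e [[m [k ->]] te] <-].
by move: te; rewrite mu_dyadic_cube lee_fin => tm; exact: H.
Qed.

Lemma abs_mean_le_net_average f t m k : (t <= 2 `^ (n%:R * - m%:~R))%R ->
  (abs_mean f (dyadic_cube m k))%:E <= net_average cubes f t.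
Proof. by move=> tm; exact: (net_average_leP f t _).1. Qed.

(** The supremum that defines the average is over a nonempty family only because
    there are dyadic cubes of arbitrarily large measure; this is where the
    dimension must be positive. *)
Lemma net_average_ge0 f t : (0 < n)%N -> 0 <= net_average cubes f t.
Proof.
move=> n0; set m : int := - (`|Num.ceil (ln t / ln 2)| : int).
apply: le_trans (@abs_mean_le_net_average f t m (fun=> 0%R) _).
  by rewrite lee_fin abs_mean_ge0.
have [t0|t0] := leP t 0%R; first by apply: le_trans t0 _; exact: powR_ge0.
rewrite [leLHS](pow2_log t0) ler_pow2 /m rmorphN/= opprK.
apply: le_trans (ceil_ge _) _; set c := Num.ceil _.
apply: (@le_trans _ _ (`|c|%:~R)%R); first by rewrite ler_int ler_norm.
by rewrite ler_peMl ?ler0z// ler1n.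
Qed.

Lemma net_average_anti f t s : (t <= s)%R ->
  net_average cubes f s <= net_average cubes f t.
Proof.
move=> ts; apply/net_average_leP => m k sm.
by apply: abs_mean_le_net_average; exact: le_trans sm.
Qed.

(** The measures of dyadic cubes are the powers of 2^n, so no cube has its
    measure in [t, 2^(n j)) when t is in the j-th block. *)
Lemma net_average_block f j t : (0 < n)%N -> block (n%:R : R) j t ->
  net_average cubes f t = net_average cubes f (2 `^ (n%:R * j%:~R)).
Proof.
move=> n0 /block_log[u [-> ul ur]].
have nR : (0 < n%:R :> R)%R by rewrite ltr0n.
apply/le_anti/andP; split; last by apply: net_average_anti; rewrite ler_pow2.
apply/net_average_leP => m k um; apply: abs_mean_le_net_average.
rewrite ler_pow2 in um; have := lt_le_trans ul um.
rewrite ler_pow2 ltr_pM2l// ler_pM2l//.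
rewrite -rmorphN -[X in (_ - X)%R]/(1%:~R) -rmorphB/= ltr_int ler_int.
by rewrite ltrBlDr ltzD1.
Qed.

Lemma net_average_add f g t : net_integrable cubes f -> net_integrable cubes g ->
  net_average cubes (f \+ g)%R t <= net_average cubes f t + net_average cubes g t.
Proof.
move=> fi gi; apply/net_average_leP => m k tm.
apply: le_trans (leeD (abs_mean_le_net_average f k tm)
                      (abs_mean_le_net_average g k tm)).
rewrite -EFinD lee_fin -mulrDr ler_wpM2l ?invr_ge0 ?fine_ge0//.
rewrite RintegralD ?ler_normD//; first exact: measurable_dyadic_cube.
- by apply: fi; exists m, k.
- by apply: gi; exists m, k.
Qed.

Lemma net_integrable_ae f g : measurable_fun setT f -> measurable_fun setT g ->
  f = g %[ae mu] -> net_integrable cubes f -> net_integrable cubes g.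
Proof.
move=> mf mg fg fi e ce; have := fi e ce; move: ce => [m [k ->]].
have mQ := @measurable_dyadic_cube R n m k.
move=> /integrableP[mfQ fiQ].
have mgQ : measurable_fun (dyadic_cube m k) (EFin \o g).
  by apply/measurable_EFinP; apply: measurable_funTS.
apply/integrableP; split => //; apply: le_lt_trans fiQ.
rewrite le_eqVlt; apply/orP; left; apply/eqP.
apply: ae_eq_integral => //; [exact: measurableT_comp|exact: measurableT_comp|].
by apply: filterS fg => x /(_ I) fgx _ /=; rewrite fgx.
Qed.

Lemma net_average_ae f g t : measurable_fun setT f -> measurable_fun setT g ->
  f = g %[ae mu] -> net_average cubes f t = net_average cubes g t.
Proof.
move=> mf mg fg; rewrite !net_averageE; congr ereal_sup.
have E e : cubes e -> abs_mean f e = abs_mean g e.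
  move=> [m [k ->]]; rewrite /abs_mean; congr (_ * `| _ |)%R.
  rewrite /Rintegral; congr fine; apply: ae_eq_integral.
  - exact: measurable_dyadic_cube.
  - by apply/measurable_EFinP; apply: measurable_funTS.
  - by apply/measurable_EFinP; apply: measurable_funTS.
  - by apply: filterS fg => x /(_ I) fgx _ /=; rewrite fgx.
by apply/seteqP; split => _ [e [ce te] <-]; exists e => //; rewrite E.
Qed.

End averages.


(** * Representatives of almost everywhere classes *)

Section L0_repr.
Context d (T : measurableType d) (R : realType) (mu : {measure set T -> \bar R}).

Lemma L0_repr_class (f : {mfun T >-> R}) : L0_repr (L0_class mu f) = f %[ae mu].
Proof. by apply/L0_class_eqP; rewrite L0_reprK. Qed.

Lemma L0_reprD (a b : L0 mu) : L0_repr (a + b) = L0_repr a \+ L0_repr b %[ae mu].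
Proof.
have : L0_class mu (L0_repr a + L0_repr b) = a + b by rewrite L0_classD !L0_reprK.
by move=> <-; exact: L0_repr_class.
Qed.

End L0_repr.

(** * The Peetre functional at dyadic scales *)

Section mellin_norm_ge0.
Context {R : realType}.
Local Open Scope ereal_scope.

Lemma mellin_norm_ge0 (q : \bar R) (phi : R -> \bar R) :
  (forall t, (0 < t)%R -> 0 <= phi t) -> 0 <= mellin_norm q phi.
Proof.
move=> phi0; case: q => [r| |] //=; first exact: poweR_ge0.
apply: le_trans (phi0 1%R ltr01) _; apply: ereal_sup_ubound; exists 1%R => //=.
by rewrite in_itv/= ltr01.
Qed.

End mellin_norm_ge0.

Section interp_seq.
Context {R : realType} {V : zmodType}.
Variables (A0 A1 : qspace R V).
Hypotheses (A0_ge0 : forall a, (0 <= qnorm A0 a)%E)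
           (A1_ge0 : forall a, (0 <= qnorm A1 a)%E).
Local Open Scope ereal_scope.

Lemma peetreK_ge0 t a : (0 <= t)%R -> 0 <= peetreK A0 A1 t a.
Proof.
move=> t0; apply: le_ereal_inf_tmp => _ [a0 [a1 [_ _ _ ->]]].
by rewrite adde_ge0// mule_ge0.
Qed.

Lemma peetreK_homo t s a : (t <= s)%R ->
  peetreK A0 A1 t a <= peetreK A0 A1 s a.
Proof.
move=> ts; apply: le_ereal_inf_tmp => _ [a0 [a1 [A0a0 A1a1 aE ->]]].
apply: ge_ereal_inf; exists (qnorm A0 a0 + t%:E * qnorm A1 a1).
  by exists a0, a1.
by rewrite leeD2l// lee_wpmul2r// lee_fin.
Qed.

(** K(t)/t is nonincreasing in t. *)
Lemma peetreK_scale c t a : (1 <= c)%R -> (0 <= t)%R ->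
  peetreK A0 A1 (c * t) a <= c%:E * peetreK A0 A1 t a.
Proof.
move=> c1 t0; have c0 : (0 < c)%R by exact: lt_le_trans c1.
rewrite muleC -lee_pdivrMr//.
apply: le_ereal_inf_tmp => _ [a0 [a1 [A0a0 A1a1 aE ->]]].
rewrite lee_pdivrMr//.
apply: ge_ereal_inf; exists (qnorm A0 a0 + (c * t)%:E * qnorm A1 a1).
  by exists a0, a1.
rewrite [leRHS]muleC ge0_muleDr// ?mule_ge0// muleA -EFinM leeD2r//.
by rewrite lee_pemull// lee_fin.
Qed.

Definition interp_seq (h theta : R) a (j : int) : \bar R :=
  (2 `^ (- (h * theta * j%:~R)))%:E * peetreK A0 A1 (2 `^ (h * j%:~R)) a.

Lemma interp_seq_ge0 h theta a j : 0 <= interp_seq h theta a j.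
Proof. by rewrite mule_ge0 ?lee_fin ?powR_ge0// peetreK_ge0// powR_ge0. Qed.

(** Valid for every pair with nonnegative quasi-norms: K varies by a factor of
    at most 2^h over a block, by [peetreK_homo] and [peetreK_scale]. *)
Lemma interp_norm_equiv h theta q : (0 < h)%R -> (0 <= theta)%R -> 0 < q ->
  exists2 C : R, (0 < C)%R & forall a,
    interp_norm A0 A1 theta q a <= C%:E * lq q (interp_seq h theta a) /\
    lq q (interp_seq h theta a) <= C%:E * interp_norm A0 A1 theta q a.
Proof.
move=> h0 th0 q0; have [C C0 HC] := mellin_norm_le_lq h0 q0.
have [D D0 HD] := lq_le_mellin_norm h0 q0.
pose c : R := (2 `^ (h * theta))%R; pose b : R := (2 `^ h)%R.
have c0 : (0 < c)%R by exact: pow2_gt0.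
have b0 : (0 < b)%R by exact: pow2_gt0.
exists (Num.max (C * c) (D * b))%R; first by rewrite lt_max mulr_gt0.
have phi0 a t : (0 < t)%R -> 0 <= (t `^ (- theta))%:E * peetreK A0 A1 t a.
  by move=> t0; rewrite mule_ge0 ?lee_fin ?powR_ge0// peetreK_ge0// ltW.
have n0 a : 0 <= interp_norm A0 A1 theta q a.
  by apply: mellin_norm_ge0; exact: phi0.
move=> a; set y := interp_seq h theta a.
have y0 j : 0 <= y j by exact: interp_seq_ge0.
split.
  apply: (@le_trans _ _ ((C * c)%:E * lq q y)); last first.
    by apply: lee_wpmul2r; [exact: lq_ge0|rewrite lee_fin le_max lexx].
  rewrite EFinM -muleA -(lqZ q0 (ltW c0) y0); apply: HC; first exact: phi0.
    move=> j _ /block_log[u [-> ul ur]].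
    rewrite /y /interp_seq muleA -EFinM; apply: lee_pmul.
    - by rewrite lee_fin powR_ge0.
    - by rewrite peetreK_ge0// powR_ge0.
    - rewrite lee_fin /c -pow2D -powRrM ler_pow2.
      by move/ltW/(ler_wpM2r th0) : ul; nra.
    - by apply: peetreK_homo; rewrite ler_pow2.
  by move=> j; rewrite mule_ge0// lee_fin ltW.
apply: (@le_trans _ _ ((D * b)%:E * interp_norm A0 A1 theta q a)); last first.
  by apply: lee_wpmul2r => //; rewrite lee_fin le_max lexx orbT.
have bi0 : (0 <= b^-1)%R by rewrite invr_ge0 ltW.
rewrite mulrC EFinM -muleA -lee_pdivrMl// -(lqZ q0 bi0 y0).
apply: HD => [j t|j]; last by rewrite mule_ge0// lee_fin.
move=> /block_log[u [-> ul ur]].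
rewrite lee_pdivrMl// /y /interp_seq muleCA; apply: lee_pmul.
- by rewrite lee_fin powR_ge0.
- by rewrite peetreK_ge0// powR_ge0.
- rewrite lee_fin -powRrM ler_pow2.
  by move/(ler_wpM2r th0) : ur; nra.
- apply: le_trans (peetreK_scale a _ (powR_ge0 _ _)); last first.
    by rewrite /b -[leLHS](powRr0 2) ler_pow2 ltW.
  by apply: peetreK_homo; rewrite /b -pow2D ler_pow2; lra.
Qed.

End interp_seq.


(** * The net quasi-norm at dyadic scales *)

Section net_seq.
Context {R : realType} {n : nat}.
Hypothesis n_gt0 : (0 < n)%N.
Local Notation mu := (lebesgue_tuple R n).
Local Notation cubes := (dyadic_cubes R n).
Implicit Types (f g : Rn R n -> R) (a : L0 mu) (s p : R) (q : \bar R).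
Local Open Scope ereal_scope.

Let n0 : (0 < n%:R :> R)%R. Proof. by rewrite ltr0n. Qed.

Definition net_level f (j : int) : \bar R :=
  net_average cubes f (2 `^ (n%:R * j%:~R)).

Definition net_seq s f (j : int) : \bar R :=
  (2 `^ (n%:R * s * j%:~R))%:E * net_level f j.

Lemma net_level_ge0 f j : 0 <= net_level f j.
Proof. exact: net_average_ge0. Qed.

Lemma net_seq_ge0 s f j : 0 <= net_seq s f j.
Proof. by rewrite mule_ge0 ?net_level_ge0// lee_fin powR_ge0. Qed.

Lemma net_norm_ge0 p q f : 0 <= net_norm cubes p%:E q f.
Proof.
apply: mellin_norm_ge0 => t t0.
by rewrite mule_ge0 ?net_average_ge0// lee_fin powR_ge0.
Qed.

Lemma net_norm_equiv p q : (0 < p)%R -> 0 < q ->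
  exists2 C : R, (0 < C)%R & forall f,
    net_norm cubes p%:E q f <= C%:E * lq q (net_seq p^-1 f) /\
    lq q (net_seq p^-1 f) <= C%:E * net_norm cubes p%:E q f.
Proof.
move=> p0 q0; have [C C0 HC] := mellin_norm_le_lq n0 q0.
have [D D0 HD] := lq_le_mellin_norm n0 q0.
have s0 : (0 <= p^-1)%R by rewrite invr_ge0 ltW.
have fp : fine (p%:E^-1) = (p^-1)%R by rewrite inver gt_eqF.
pose b : R := (2 `^ (n%:R * p^-1))%R.
have b0 : (0 < b)%R by exact: pow2_gt0.
exists (Num.max C (D * b))%R; first by rewrite lt_max C0.
move=> f; have x0 := net_seq_ge0 p^-1 f; split.
  apply: (@le_trans _ _ (C%:E * lq q (net_seq p^-1 f))); last first.
    by apply: lee_wpmul2r; [exact: lq_ge0|rewrite lee_fin le_max lexx].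
  rewrite /net_norm fp; apply: HC => // [t t0|j t jt].
    by rewrite mule_ge0 ?net_average_ge0// lee_fin powR_ge0.
  rewrite (net_average_block _ n_gt0 jt) lee_wpmul2r ?net_level_ge0// lee_fin.
  have /block_log[u [-> _ ur]] := jt.
  by rewrite -powRrM ler_pow2 mulrAC ler_wpM2r.
apply: (@le_trans _ _ ((D * b)%:E * net_norm cubes p%:E q f)); last first.
  by apply: lee_wpmul2r; [exact: net_norm_ge0|rewrite lee_fin le_max lexx orbT].
have bi0 : (0 <= b^-1)%R by rewrite invr_ge0 ltW.
rewrite mulrC EFinM -muleA -lee_pdivrMl// -(lqZ q0 bi0 x0).
rewrite /net_norm fp; apply: HD => [j t jt|j]; last by rewrite mule_ge0// lee_fin.
rewrite lee_pdivrMl// muleA (net_average_block _ n_gt0 jt).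
apply: lee_wpmul2r; first exact: net_level_ge0.
have /block_log[u [-> ul _]] := jt.
rewrite -EFinM lee_fin /b -powRrM -pow2D ler_pow2.
by move: ul => /ltW /(ler_wpM2r s0); nra.
Qed.

End net_seq.

(** * Splitting by conditional expectation *)

Section net_level_L0.
Context {R : realType} {n : nat}.
Hypothesis n_gt0 : (0 < n)%N.
Local Notation mu := (lebesgue_tuple R n).
Local Notation cubes := (dyadic_cubes R n).
Implicit Types (a : L0 mu).
Local Open Scope ereal_scope.

Lemma net_level_add a0 a1 j :
  net_integrable cubes (L0_repr a0) -> net_integrable cubes (L0_repr a1) ->
  net_level (L0_repr (a0 + a1)%R) j <=
  net_level (L0_repr a0) j + net_level (L0_repr a1) j.
Proof.
move=> i0 i1; rewrite /net_level (net_average_ae _ _ _ (L0_reprD a0 a1)) //.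
exact: net_average_add.
Qed.

Lemma net_integrable_add a0 a1 :
  net_integrable cubes (L0_repr a0) -> net_integrable cubes (L0_repr a1) ->
  net_integrable cubes (L0_repr (a0 + a1)%R).
Proof.
move=> i0 i1; apply: (@net_integrable_ae _ _ (L0_repr a0 \+ L0_repr a1)%R) => //.
- apply: filterS (L0_reprD a0 a1) => x /(_ I) H _; exact/esym/H.
- move=> e ce; have [m [k E]] := ce.
  have me : measurable e by rewrite E; exact: measurable_dyadic_cube.
  exact: (integrableD me (i0 _ ce) (i1 _ ce)).
Qed.

(** The summands are f - g and g, with g the conditional expectation of f on
    cubes of measure 2^(n j). Above that scale f and g have the same integrals;
    below it the average of g is that of f over the surrounding cube, whose
    measure is still at least 2^(n i). *)
Lemma net_decomposition a (j : int) : net_integrable cubes (L0_repr a) ->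
  exists a0 a1, [/\ a = (a0 + a1)%R,
    net_integrable cubes (L0_repr a0), net_integrable cubes (L0_repr a1),
    (forall i, net_level (L0_repr a0) i <=
       if (i <= j)%R then 2%:E * net_level (L0_repr a) i else 0) &
    (forall i, net_level (L0_repr a1) i <= net_level (L0_repr a) (Num.max i j))].
Proof.
move=> fi; set f := L0_repr a in fi *; set m := (- j)%R.
pose g : {mfun Rn R n >-> R} := dyadic_mean f m.
pose b : {mfun Rn R n >-> R} := (f - g)%R.
have gi : net_integrable cubes g by exact: net_integrable_dyadic_mean.
have bi : net_integrable cubes b.
  move=> e ce; have [k [l E]] := ce.
  have me : measurable e by rewrite E; exact: measurable_dyadic_cube.
  exact: (integrableB me (fi _ ce) (gi _ ce)).
have bE : L0_repr (L0_class mu b) = b %[ae mu] by exact: L0_repr_class.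
have gE : L0_repr (L0_class mu g) = g %[ae mu] by exact: L0_repr_class.
have sym (f1 f2 : {mfun Rn R n >-> R}) : f1 = f2 %[ae mu] -> f2 = f1 %[ae mu].
  by apply: filterS => x /(_ I) H _; exact/esym/H.
have levelP i (h : Rn R n -> R) c : net_level h i <= c <-> forall m' k,
    (i <= - m')%R -> (abs_mean h (dyadic_cube m' k))%:E <= c.
  rewrite /net_level net_average_leP; split => H m' k im; apply: H.
    by rewrite ler_pow2 ler_pM2l ?ltr0n// -rmorphN ler_int.
  by move: im; rewrite ler_pow2 ler_pM2l ?ltr0n// -rmorphN ler_int.
have mean_level i m' k : (i <= - m')%R ->
    (abs_mean f (dyadic_cube m' k))%:E <= net_level f i.
  by move=> im; apply: (levelP i f _).1.
exists (L0_class mu b), (L0_class mu g); split.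
- by rewrite -L0_classD /b subrK L0_reprK.
- by apply: net_integrable_ae bi => //; exact: sym.
- by apply: net_integrable_ae gi => //; exact: sym.
- move=> i; rewrite /net_level (net_average_ae _ _ _ bE)// -/(net_level b i).
  have bmean m' k : (abs_mean b (dyadic_cube m' k) <=
      abs_mean f (dyadic_cube m' k) + abs_mean g (dyadic_cube m' k))%R.
    rewrite /abs_mean -mulrDr ler_wpM2l ?invr_ge0 ?fine_ge0// /b.
    rewrite RintegralB ?ler_normB//; first exact: measurable_dyadic_cube.
    - by apply: fi; exists m', k.
    - by apply: gi; exists m', k.
  have gmean m' k : (i <= j)%R -> (i <= - m')%R ->
      (abs_mean g (dyadic_cube m' k))%:E <= net_level f i.
    move=> ij im; have [m'm|/ltW mm'] := leP m' m.
      by rewrite abs_mean_dyadic_mean_large//; exact: mean_level.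
    have [k' ->] := @abs_mean_dyadic_mean_small _ _ f m m' k mm'.
    by apply: mean_level; rewrite /m opprK.
  apply/levelP => m' k im; case: ifPn => [ij|]; last first.
    rewrite -ltNge => ji; rewrite lee_fin /abs_mean /b.
    rewrite RintegralB; last 3 first.
    - exact: measurable_dyadic_cube.
    - by apply: fi; exists m', k.
    - by apply: gi; exists m', k.
    rewrite /Rintegral integral_dyadic_mean// ?subrr ?normr0 ?mulr0//.
    by rewrite /m lerNr ltW// (lt_le_trans ji).
  apply: (@le_trans _ _ ((abs_mean f (dyadic_cube m' k))%:E +
                         (abs_mean g (dyadic_cube m' k))%:E)).
    by rewrite -EFinD lee_fin.
  rewrite mule_natl mule2n; apply: leeD; [exact: mean_level|exact: gmean].
- move=> i; rewrite /net_level (net_average_ae _ _ _ gE)// -/(net_level g i).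
  rewrite -/(net_level f (Num.max i j)).
  apply/levelP => m' k im; have [m'm|/ltW mm'] := leP m' m.
    rewrite abs_mean_dyadic_mean_large//; apply: mean_level.
    by rewrite ge_max im lerNr.
  have [k' ->] := @abs_mean_dyadic_mean_small _ _ f m m' k mm'.
  apply: mean_level; rewrite /m opprK ge_max lexx andbT.
  by apply: le_trans im _; rewrite lerNl.
Qed.

End net_level_L0.


(** * Estimates of the Peetre functional for net spaces *)

Section interpolation_of_net_spaces.
Context {R : realType} {n : nat}.
Variables (p0 p1 : R) (q0 q1 : \bar R).
Hypotheses (n_gt0 : (0 < n)%N) (p0_gt0 : 0 < p0) (p0_lt_p1 : p0 < p1)
  (q0_gt0 : (0 < q0)%E) (q1_gt0 : (0 < q1)%E).
Local Notation mu := (lebesgue_tuple R n).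
Local Notation cubes := (dyadic_cubes R n).
Local Notation A0 := (net_space cubes p0%:E q0).
Local Notation A1 := (net_space cubes p1%:E q1).
Implicit Types (a : L0 mu) (j : int).

Let p1_gt0 : 0 < p1. Proof. exact: lt_trans p0_lt_p1. Qed.

(** The scale 2^(n j) of the averages corresponds to the parameter
    2^(step_exponent * j) of the Peetre functional. *)
Definition step_exponent : R := n%:R * (p0^-1 - p1^-1).
Local Notation h := step_exponent.

Lemma step_exponent_gt0 : 0 < h.
Proof. by rewrite mulr_gt0 ?ltr0n// subr_gt0 ltf_pV2 ?posrE. Qed.

Lemma net_seq_change s s' (f : Rn R n -> R) j :
  net_seq s f j = ((2 `^ (n%:R * (s - s') * j%:~R))%:E * net_seq s' f j)%E.
Proof.
by rewrite /net_seq muleA -EFinM -pow2D; congr ((2 `^ _)%:E * _)%E; ring.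
Qed.

Local Open Scope ereal_scope.

(** Termwise bounds for the two summands suffice, because a term of a sequence
    is at most its l^q quasi-norm; the values of q0 and q1 only enter the
    constant. *)
Lemma net_seq_le_peetreK : exists2 C : R, (0 < C)%R & forall a j,
  net_seq p0^-1 (L0_repr a) j <= C%:E * peetreK A0 A1 (2 `^ (h * j%:~R)) a.
Proof.
have [C0 C00 H0] := net_norm_equiv n_gt0 p0_gt0 q0_gt0.
have [C1 C10 H1] := net_norm_equiv n_gt0 p1_gt0 q1_gt0.
exists (Num.max C0 C1)%R; first by rewrite lt_max C00.
have C_gt0 : (0 < Num.max C0 C1)%R by rewrite lt_max C00.
move=> a j; rewrite -lee_pdivrMl//.
apply: le_ereal_inf_tmp => _ [a0 [a1 [[i0 _] [i1 _] -> ->]]].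
rewrite lee_pdivrMl// /=.
set t : R := (2 `^ (h * j%:~R))%R; have t0 : (0 <= t)%R by exact: powR_ge0.
apply: (@le_trans _ _ (net_seq p0^-1 (L0_repr a0) j +
                       t%:E * net_seq p1^-1 (L0_repr a1) j)).
  rewrite /t -net_seq_change -ge0_muleDr; [|exact: net_level_ge0..].
  by rewrite lee_wpmul2l ?lee_fin ?powR_ge0//; exact: net_level_add.
have N0 : 0 <= net_norm cubes p0%:E q0 (L0_repr a0) by exact: net_norm_ge0.
have N1 : 0 <= net_norm cubes p1%:E q1 (L0_repr a1) by exact: net_norm_ge0.
rewrite ge0_muleDr ?mule_ge0//; apply: leeD.
  apply: le_trans (lq_term j q0_gt0 (net_seq_ge0 n_gt0 _ _)) _.
  apply: le_trans (H0 _).2 _.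
  by rewrite lee_wpmul2r// lee_fin le_max lexx.
rewrite [leRHS]muleCA lee_wpmul2l//.
apply: le_trans (lq_term j q1_gt0 (net_seq_ge0 n_gt0 _ _)) _.
apply: le_trans (H1 _).2 _.
by rewrite lee_wpmul2r// lee_fin le_max lexx orbT.
Qed.

Section upper_bound.
Variables (p theta d e : R).
Hypotheses (pE : (p^-1 = (1 - theta) / p0 + theta / p1)%R)
  (e_gt0 : (0 < e)%R) (de0 : (d + e <= h * theta)%R)
  (de1 : (d + e <= h * (1 - theta))%R) (e1 : (e <= n%:R / p1)%R).

(** S is a weighted supremum bound for the sequence of f around j.
    Both summands of [net_decomposition] then have sequences bounded by a
    multiple of S times the weight 2^(-e|i-j|), which has finite l^q quasi-norm
    for every q. The condition on d + e and theta serves the scales i <= j of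
    the first summand, the one with 1 - theta the scales i >= j of the second,
    and the last one the scales i < j of the second, where its averages are
    bounded by a constant. *)
Lemma net_splitting : exists2 C : R, (0 < C)%R & forall a j (S : R),
  net_integrable cubes (L0_repr a) -> (0 <= S)%R ->
  (forall i, net_seq p^-1 (L0_repr a) i <=
             (2 `^ (d * `|(i - j)%:~R|) * S)%:E) ->
  exists a0 a1, [/\ qcar A0 a0, qcar A1 a1, a = (a0 + a1)%R &
    qnorm A0 a0 + (2 `^ (h * j%:~R))%:E * qnorm A1 a1 <=
    (C * (2 `^ (h * theta * j%:~R) * S))%:E].
Proof.
have [C0 C00 H0] := net_norm_equiv n_gt0 p0_gt0 q0_gt0.
have [C1 C10 H1] := net_norm_equiv n_gt0 p1_gt0 q1_gt0.
have geo0 j : 0 <= (geo e j)%:E by rewrite lee_fin geo_ge0.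
have [g0 g00 g0E] : exists2 g : R, (0 <= g)%R &
    lq q0 (fun j => (geo e j)%:E) = g%:E.
  exists (fine (lq q0 (fun j => (geo e j)%:E))).
    by rewrite fine_ge0// lq_ge0.
  by rewrite fineK// ge0_fin_numE ?lq_ge0// lq_geo_lty.
have [g1 g10 g1E] : exists2 g : R, (0 <= g)%R &
    lq q1 (fun j => (geo e j)%:E) = g%:E.
  exists (fine (lq q1 (fun j => (geo e j)%:E))).
    by rewrite fine_ge0// lq_ge0.
  by rewrite fineK// ge0_fin_numE ?lq_ge0// lq_geo_lty.
(* The summand 1 makes the constant positive: g0 and g1 are only known to be
   nonnegative. *)
exists (1 + C0 * 2 * g0 + C1 * g1)%R.
  by rewrite -addrA ltr_pwDl// addr_ge0// !mulr_ge0// ltW.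
move=> a j S fi S0 HS; set f := L0_repr a in fi HS *.
have [a0 [a1 [aE i0 i1 L0i L1i]]] := net_decomposition n_gt0 j fi.
have hth0 : (n%:R * (p0^-1 - p^-1) = h * theta)%R.
  by rewrite pE /h /step_exponent; ring.
have hth1 : (n%:R * (p1^-1 - p^-1) = - (h * (1 - theta)))%R.
  by rewrite pE /h /step_exponent; ring.
have N0 : net_norm cubes p0%:E q0 (L0_repr a0) <=
    (C0 * 2 * g0 * (2 `^ (h * theta * j%:~R) * S))%:E.
  apply: le_trans (H0 _).1 _.
  pose c : R := (2 * (2 `^ (h * theta * j%:~R) * S))%R.
  have c0 : (0 <= c)%R by rewrite !mulr_ge0// powR_ge0.
  rewrite [leRHS](_ : _ = C0%:E * (c%:E * g0%:E)); last first.
    by rewrite -!EFinM /c; congr _%:E; ring.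
  apply: lee_wpmul2l; first by rewrite lee_fin ltW.
  rewrite -g0E -[X in _ * X](lq_shift _ _ (- j)) -lqZ//.
  apply: le_lq => // i; first exact: net_seq_ge0.
  apply: (@le_trans _ _ ((2 `^ (n%:R * p0^-1 * i%:~R))%:E *
    (if (i <= j)%R then 2%:E * net_level f i else 0))).
    by rewrite lee_wpmul2l ?lee_fin ?powR_ge0//; exact: L0i.
  case: ifPn => ij; last by rewrite mule0 mule_ge0.
  rewrite muleCA -/(net_seq _ _ _) (net_seq_change _ p^-1) hth0.
  rewrite /c EFinM -muleA lee_wpmul2l// -EFinM.
  apply: (@le_trans _ _ ((2 `^ (h * theta * i%:~R))%:E *
    (2 `^ (d * `|(i - j)%:~R|) * S)%:E)).
    by rewrite lee_wpmul2l ?lee_fin ?powR_ge0.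
  rewrite -EFinM lee_fin [leLHS]mulrA -pow2D /geo [leRHS]mulrAC -pow2D.
  rewrite ler_wpM2r// ler_pow2.
  have ijR : (i%:~R <= j%:~R :> R)%R by rewrite ler_int.
  have -> : `|(i - j)%:~R : R|%R = (j%:~R - i%:~R)%R.
    by rewrite rmorphB/= ler0_norm ?opprB// subr_le0.
  have : (0 <= j%:~R - i%:~R :> R)%R by rewrite subr_ge0.
  move/ler_wpM2r/(_ _ _ de0) => /=; lra.
have N1 : net_norm cubes p1%:E q1 (L0_repr a1) <=
    (C1 * g1 * (2 `^ (- (h * (1 - theta) * j%:~R)) * S))%:E.
  apply: le_trans (H1 _).1 _.
  pose c : R := (2 `^ (- (h * (1 - theta) * j%:~R)) * S)%R.
  have c0 : (0 <= c)%R by rewrite !mulr_ge0// powR_ge0.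
  rewrite [leRHS](_ : _ = C1%:E * (c%:E * g1%:E)); last first.
    by rewrite -!EFinM /c; congr _%:E; ring.
  apply: lee_wpmul2l; first by rewrite lee_fin ltW.
  rewrite -g1E -[X in _ * X](lq_shift _ _ (- j)) -lqZ//.
  apply: le_lq => // i; first exact: net_seq_ge0.
  apply: (@le_trans _ _ ((2 `^ (n%:R * p1^-1 * i%:~R))%:E *
    net_level f (Num.max i j))).
    by rewrite lee_wpmul2l ?lee_fin ?powR_ge0//; exact: L1i.
  have [ij|/ltW ji] := leP i j.
    pose b : R := (n%:R / p1 * i%:~R - n%:R / p1 * j%:~R
                   - h * (1 - theta) * j%:~R)%R.
    have -> : (2 `^ (n%:R * p1^-1 * i%:~R))%:E * net_level f j =
        (2 `^ b)%:E * net_seq p^-1 f j.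
      rewrite /net_seq muleA -EFinM -pow2D; congr ((2 `^ _)%:E * _).
      have := congr1 (fun v => v * j%:~R)%R hth1; rewrite /b; lra.
    apply: (@le_trans _ _ ((2 `^ b)%:E * (2 `^ (d * `|(j - j)%:~R|) * S)%:E)).
      by rewrite lee_wpmul2l ?lee_fin ?powR_ge0.
    rewrite subrr normr0 mulr0 powRr0 mul1r -!EFinM lee_fin.
    rewrite /b /c /geo [leRHS]mulrAC -pow2D.
    rewrite ler_wpM2r// ler_pow2.
    have ijR : (i%:~R <= j%:~R :> R)%R by rewrite ler_int.
    have -> : `|(i - j)%:~R : R|%R = (j%:~R - i%:~R)%R.
      by rewrite rmorphB/= ler0_norm ?opprB// subr_le0.
    have : (0 <= j%:~R - i%:~R :> R)%R by rewrite subr_ge0.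
    move/ler_wpM2r/(_ _ _ e1) => /=; lra.
  rewrite -/(net_seq _ _ _) (net_seq_change _ p^-1) hth1.
  apply: (@le_trans _ _ ((2 `^ (- (h * (1 - theta)) * i%:~R))%:E *
    (2 `^ (d * `|(i - j)%:~R|) * S)%:E)).
    by rewrite lee_wpmul2l ?lee_fin ?powR_ge0.
  rewrite -!EFinM lee_fin [leLHS]mulrA -pow2D /c /geo [leRHS]mulrAC -pow2D.
  rewrite ler_wpM2r// ler_pow2.
  have ijR : (j%:~R <= i%:~R :> R)%R by rewrite ler_int.
  have -> : `|(i - j)%:~R : R|%R = (i%:~R - j%:~R)%R.
    by rewrite rmorphB/= ger0_norm// subr_ge0.
  have : (0 <= i%:~R - j%:~R :> R)%R by rewrite subr_ge0.
  move/ler_wpM2r/(_ _ _ de1) => /=; lra.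
exists a0, a1; split => //.
- by split => //; apply: le_lt_trans N0 _; exact: ltry.
- by split => //; apply: le_lt_trans N1 _; exact: ltry.
apply: le_trans (leeD N0 (lee_wpmul2l _ N1)) _; first by rewrite lee_fin powR_ge0.
rewrite -EFinM -EFinD lee_fin.
rewrite (_ : (2 `^ (h * j%:~R) * _ =
    C1 * g1 * (2 `^ (h * theta * j%:~R) * S))%R); last first.
  rewrite mulrCA; congr (_ * _)%R; rewrite mulrA -pow2D.
  by congr (2 `^ _ * _)%R; ring.
rewrite -mulrDl ler_wpM2r ?mulr_ge0 ?powR_ge0//.
by rewrite -addrA lerDr.
Qed.

End upper_bound.

End interpolation_of_net_spaces.


(** * Comparison of the quasi-norms *)

Section same_space.
Context {R : realType} {n : nat}.
Variables (p0 p1 p theta : R) (q0 q1 q : \bar R).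
Hypotheses (n_gt0 : (0 < n)%N)
    (p0_gt0 : 0 < p0) (p0_lt_p1 : p0 < p1)
    (q0_gt0 : (0 < q0)%E) (q1_gt0 : (0 < q1)%E) (q_gt0 : (0 < q)%E)
    (theta_gt0 : 0 < theta) (theta_lt1 : theta < 1)
    (pE : p^-1 = (1 - theta) / p0 + theta / p1).
Local Notation mu := (lebesgue_tuple R n).
Local Notation cubes := (dyadic_cubes R n).
Local Notation A0 := (net_space cubes p0%:E q0).
Local Notation A1 := (net_space cubes p1%:E q1).
Local Notation h := (@step_exponent R n p0 p1).
Implicit Types (a : L0 mu) (j : int).
Local Open Scope ereal_scope.

Let p1_gt0 : (0 < p1)%R. Proof. exact: lt_trans p0_lt_p1. Qed.

Let p_gt0 : (0 < p)%R.
Proof.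
by rewrite -invr_gt0 pE addr_gt0// divr_gt0// subr_gt0.
Qed.

Let h_gt0 : (0 < h)%R. Proof. exact: step_exponent_gt0. Qed.

Let A0_ge0 a : 0 <= qnorm A0 a. Proof. exact: net_norm_ge0. Qed.
Let A1_ge0 a : 0 <= qnorm A1 a. Proof. exact: net_norm_ge0. Qed.

Lemma net_norm_le_interp_norm : exists2 C : R, (0 < C)%R & forall a,
  net_norm cubes p%:E q (L0_repr a) <= C%:E * interp_norm A0 A1 theta q a.
Proof.
have [C C0 HC] := net_norm_equiv n_gt0 p_gt0 q_gt0.
have [D D0 HD] := interp_norm_equiv A0_ge0 A1_ge0 h_gt0 (ltW theta_gt0) q_gt0.
have [K K0 HK] := net_seq_le_peetreK n_gt0 p0_gt0 p0_lt_p1 q0_gt0 q1_gt0.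
exists (C * (K * D))%R; first by rewrite !mulr_gt0.
move=> a; apply: le_trans (HC _).1 _.
rewrite 2!EFinM -!muleA; apply: lee_wpmul2l; first by rewrite lee_fin ltW.
apply: le_trans (lee_wpmul2l _ (HD a).2); last by rewrite lee_fin ltW.
rewrite -lqZ//; last 2 first.
- exact: ltW.
- by move=> j; exact: interp_seq_ge0.
apply: le_lq => // j; first exact: net_seq_ge0.
rewrite (net_seq_change _ p0^-1) /interp_seq [leRHS]muleCA.
have -> : (n%:R * (p^-1 - p0^-1) * j%:~R = - (h * theta * j%:~R))%R.
  by rewrite pE /step_exponent; ring.
by apply: lee_wpmul2l; [rewrite lee_fin powR_ge0|exact: HK].
Qed.

(** [net_splitting] is applied at each j with S_j the l^q quasi-norm of
    i |-> 2^(-d|i|) x_(j+i), and [lq_conv] then sums over j. *)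
Lemma interp_norm_le_net_norm : exists2 C : R, (0 < C)%R & forall a,
  qcar (net_space cubes p%:E q) a -> sum_space A0 A1 a /\
  interp_norm A0 A1 theta q a <= C%:E * net_norm cubes p%:E q (L0_repr a).
Proof.
have [C C0 HC] := net_norm_equiv n_gt0 p_gt0 q_gt0.
have [D D0 HD] := interp_norm_equiv A0_ge0 A1_ge0 h_gt0 (ltW theta_gt0) q_gt0.
(* Half of the slack eps pays for the weights in S_j, the other half for the
   decay of the two summands away from j. *)
pose eps : R := (Num.min theta (1 - theta) * h)%R.
have eps0 : (0 < eps)%R by rewrite mulr_gt0// lt_min theta_gt0 subr_gt0.
pose d : R := (eps / 2)%R; pose e : R := Num.min (eps / 2)%R (n%:R / p1)%R.
have d0 : (0 < d)%R by rewrite divr_gt0.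
have e0 : (0 < e)%R by rewrite lt_min !divr_gt0// ltr0n.
have de : (d + e <= eps)%R.
  by rewrite [leRHS](splitr eps) lerD2l ge_min lexx.
have de0 : (d + e <= h * theta)%R.
  apply: le_trans de _; rewrite [leRHS]mulrC ler_wpM2r ?(ltW h_gt0)//.
  by rewrite ge_min lexx.
have de1 : (d + e <= h * (1 - theta))%R.
  apply: le_trans de _; rewrite [leRHS]mulrC ler_wpM2r ?(ltW h_gt0)//.
  by rewrite ge_min lexx orbT.
have e1 : (e <= n%:R / p1)%R by rewrite ge_min lexx orbT.
have [K K0 HK] := net_splitting n_gt0 p0_gt0 p0_lt_p1 q0_gt0 q1_gt0 pE
  e0 de0 de1 e1.
have geo0 j : 0 <= (geo d j)%:E by rewrite lee_fin geo_ge0.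
have G_fin : lq q (fun j => (geo d j)%:E) \is a fin_num.
  by rewrite ge0_fin_numE ?lq_geo_lty// lq_ge0.
set G := lq q (fun j => (geo d j)%:E) in G_fin.
have G0 : 0 <= G by exact: lq_ge0.
exists (D * (K * ((1 + fine G) * C)))%R.
  by rewrite !mulr_gt0// ltr_pwDl// fine_ge0.
move=> a [fi fn].
set x := net_seq p^-1 (L0_repr a).
have x0 j : 0 <= x j by exact: net_seq_ge0.
have lqx : lq q x < +oo.
  apply: le_lt_trans (HC _).2 _; apply: lte_mul_pinfty => //.
  by rewrite lee_fin ltW.
pose S j := lq q (fun i => (geo d i)%:E * x (j + i)%R).
have gx0 j i : 0 <= (geo d i)%:E * x (j + i)%R by rewrite mule_ge0.
have S0 j : 0 <= S j by exact: lq_ge0.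
have S_fin j : S j \is a fin_num.
  rewrite ge0_fin_numE//; apply: le_lt_trans lqx.
  rewrite -(lq_shift q x j); apply: le_lq => // i.
  rewrite addrC gee_pMl// lee_fin /geo -[leRHS](powRr0 2) ler_pow2.
  by rewrite oppr_le0 mulr_ge0// ltW.
have xS j i : x i <= (2 `^ (d * `|(i - j)%:~R|) * fine (S j))%:E.
  rewrite EFinM fineK// -lee_pdivrMl ?pow2_gt0// -powRN.
  by have := lq_term (i - j)%R q_gt0 (gx0 j); rewrite /= subrKC.
have split j := HK a j (fine (S j)) fi (fine_ge0 (S0 j)) (xS j).
split.
  have [a0 [a1 [c0 c1 aE _]]] := split 0%R.
  by exists a0, a1.
apply: le_trans (HD _).1 _.
rewrite 2!EFinM -!muleA; apply: lee_wpmul2l; first by rewrite lee_fin ltW.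
have yS j : interp_seq A0 A1 h theta a j <= K%:E * S j.
  have [a0 [a1 [c0 c1 aE aN]]] := split j.
  rewrite /interp_seq powRN lee_pdivrMl ?pow2_gt0//.
  apply: ge_ereal_inf; exists (qnorm A0 a0 + (2 `^ (h * j%:~R))%:E * qnorm A1 a1).
    by exists a0, a1.
  by apply: le_trans aN _; rewrite !EFinM fineK// muleCA.
apply: (@le_trans _ _ (lq q (fun j => K%:E * S j))).
  by apply: le_lq => // j; exact: interp_seq_ge0.
rewrite lqZ ?(ltW K0)//; apply: lee_wpmul2l; first by rewrite lee_fin ltW.
apply: le_trans (lq_conv q_gt0 (geo_ge0 d) x0) _.
rewrite -/G EFinM -muleA; apply: lee_pmul => //; first exact: lq_ge0.
  by rewrite EFinD fineK// leeDr.
exact: (HC _).2.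
Qed.

End same_space.

Unset Implicit Arguments.

Theorem theorem1 (R : realType) (n : nat) (p0 p1 p theta : R)
    (q0 q1 q : \bar R) (n_gt0 : (0 < n)%N)
    (p0_gt0 : 0 < p0) (p0_lt_p1 : p0 < p1)
    (q0_gt0 : (0 < q0)%E) (q1_gt0 : (0 < q1)%E) (q_gt0 : (0 < q)%E)
    (theta_gt0 : 0 < theta) (theta_lt1 : theta < 1)
    (pE : p^-1 = (1 - theta) / p0 + theta / p1) :
  same_qspace
    (real_interp (net_space (dyadic_cubes R n) p0%:E q0)
                 (net_space (dyadic_cubes R n) p1%:E q1) theta q)
    (net_space (dyadic_cubes R n) p%:E q).
Proof.
have [C C0 HC] := net_norm_le_interp_norm n_gt0 p0_gt0 p0_lt_p1 q0_gt0 q1_gt0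
  q_gt0 theta_gt0 theta_lt1 pE.
have [D D0 HD] := interp_norm_le_net_norm n_gt0 p0_gt0 p0_lt_p1 q0_gt0 q1_gt0
  q_gt0 theta_gt0 theta_lt1 pE.
have sub a : qcar (real_interp (net_space (dyadic_cubes R n) p0%:E q0)
    (net_space (dyadic_cubes R n) p1%:E q1) theta q) a ->
    qcar (net_space (dyadic_cubes R n) p%:E q) a.
  move=> [[a0 [a1 [[i0 _] [i1 _] aE]]] an]; split.
    by rewrite aE; exact: net_integrable_add.
  apply: le_lt_trans (HC a) _; apply: lte_mul_pinfty => //.
  by rewrite lee_fin ltW.
split.
  apply/seteqP; split => [|a aN]; first exact: sub.
  have [aS aI] := HD a aN; split => //.
  apply: le_lt_trans aI _; apply: lte_mul_pinfty => //; last exact: aN.2.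
  by rewrite lee_fin ltW.
exists D^-1, C; rewrite invr_gt0; split => // a /sub aN.
rewrite HC andbT lee_pdivrMl//; exact: (HD a aN).2.
Qed.
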